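(* Let $n\ge 1$ and let $M:=\mathcal{B}(\mathbb{R}^n,[0,1])$ be the complete metric space of all Lebesgue measurable functions $f:\mathbb{R}^n\to[0,1]$ with the supremum metric $d_\infty(f,g)=\sup_{x\in\mathbb{R}^n}|f(x)-g(x)|$. Let $K\in L^1$, i.e. $K:\mathbb{R}^n\to\mathbb{R}$ satisfies $\int_{\mathbb{R}^n}|K(x)|\,dx<\infty$, and let $G:\mathbb{R}\to\mathbb{R}$ be bounded and Lipschitz continuous. Then the Lenia arc field $X:M\times[0,1]\to M$ given by $$X_t(f)(x):=\big[f(x)+t\,G\big((K*f)(x)\big)\big]_0^1$$ satisfies Conditions E1 and E2. Thus $X$ generates a unique forward flow $F:M\times[0,\infty)\to M$ forward tangent to $X$. Moreover $F$ is approximated by Euler curves: for all $f\in M$ and $t\ge 0$, $$F_t(f)=\lim_{N\to\infty}X_{t/N}^{(N)}(f),$$ the limit being taken in $(M,d_\infty)$.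
   Context: Functions in $M$ are actual functions, not equivalence classes modulo null sets. Clip: $[x]_a^b:=\min\{\max\{a,x\},b\}$ for $a\le b$. Convolution: $(K*f)(x)=\int_{\mathbb{R}^n}K(x-y)f(y)\,dy$. $X^{(N)}_t$ denotes the $N$-fold composition $X_t\circ\cdots\circ X_t$; $X_{t/N}$ is defined once $N\ge t$. An arc field on a metric space $(M,d)$ is a continuous map $X:M\times[0,1]\to M$, written $(f,t)\mapsto X_t(f)$, with $X_0(f)=f$ for all $f\in M$. $B(f_0,r)$ denotes a metric ball. Condition E1: for each $f_0\in M$ there are constants $r>0$, $\delta>0$, $\Lambda\in\mathbb{R}$ such that $d(X_t(f),X_t(g))\le(1+t\Lambda)\,d(f,g)$ for all $f,g\in B(f_0,r)$ and $0\le t<\delta$. Condition E2: for each $f_0\in M$ there are constants $r>0$, $\delta>0$, $\Omega\in\mathbb{R}$ such that $d(X_{s+t}(f),X_t(X_s(f)))\le st\,\Omega$ for all $f\in B(f_0,r)$ and $0\le t\le s<\delta$ (with $\delta$ small enough that $s+t\le1$). A forward flow on $M$ is a continuous map $F:M\times[0,\infty)\to M$ with $F_0(f)=f$ and $F_t(F_s(f))=F_{s+t}(f)$ for all $f\in M$, $s,t\ge0$. It is forward tangent to $X$ if $\lim_{h\to0^+}\frac{d(F_{t+h}(f),X_h(F_t(f)))}{h}=0$ for all $t\ge0$, $f\in M$. *)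

(* Defs.v *)
From HB Require Import structures.
From mathcomp Require Import all_boot all_order all_algebra.
From mathcomp Require Import all_classical all_reals all_analysis.
From mathcomp Require Import measurable_realfun lra.
Set Implicit Arguments.
Unset Strict Implicit.
Unset Printing Implicit Defensive.
Import Order.TTheory GRing.Theory Num.Theory.
Import numFieldNormedType.Exports.

Local Open Scope classical_set_scope.
Local Open Scope ring_scope.

(* Lebesgue measure on R^n, n >= 1, with R^n represented by 'rV[R]_m.+1
   (n = m.+1): the Lebesgue outer measure is the infimum of the total volumes
   of the countable covers by closed boxes, and the Lebesgue measurable sets
   are the Caratheodory measurable ones. *)
Section lebesgue_rV.
Context {R : realType} {m : nat}.
Implicit Types (a b : 'rV[R]_m.+1) (A : set 'rV[R]_m.+1).

Definition box a b : set 'rV[R]_m.+1 :=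
  [set x | forall i, a 0 i <= x 0 i <= b 0 i].

Definition box_vol a b : R := \prod_i (b 0 i - a 0 i).

Definition box_cover A : set (nat -> 'rV[R]_m.+1 * 'rV[R]_m.+1) :=
  [set s : nat -> 'rV[R]_m.+1 * 'rV[R]_m.+1 |
    (forall k i, (s k).1 0 i <= (s k).2 0 i) /\
    A `<=` \bigcup_k box (s k).1 (s k).2].

Definition lebesgue_outer_rV A : \bar R :=
  ereal_inf [set (\sum_(k <oo) (box_vol (s k).1 (s k).2)%:E)%E | s in box_cover A].

Lemma box_vol_ge0 a b : (forall i, a 0 i <= b 0 i) -> 0 <= box_vol a b.
Proof. by move=> ab; apply: prodr_ge0 => i _; rewrite subr_ge0. Qed.

Local Open Scope ereal_scope.

Let lebesgue_outer_rV_ge0 A : 0 <= lebesgue_outer_rV A.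
Proof.
apply: le_ereal_inf_tmp => _ [s [sP _] <-].
by apply: nneseries_ge0 => k _ _; rewrite lee_fin box_vol_ge0.
Qed.

Let lebesgue_outer_rV0 : lebesgue_outer_rV set0 = 0.
Proof.
apply/eqP; rewrite eq_le lebesgue_outer_rV_ge0 andbT.
apply: ereal_inf_lbound; exists (fun=> (0%R, 0%R)); first by split.
by apply: eseries0 => k _ _ /=; rewrite /box_vol big_ord_recl subrr mul0r.
Qed.

Let le_lebesgue_outer_rV :
  {homo lebesgue_outer_rV : A B / A `<=` B >-> A <= B}.
Proof.
move=> A B AB; apply: le_ereal_inf => _ [s [sP Bs] <-].
by exists s => //; split=> //; apply: subset_trans Bs.
Qed.

Let lebesgue_outer_rV_sigma_subadditive : sigma_subadditive lebesgue_outer_rV.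
Proof.
move=> A; have [[i ioo]|] := pselect (exists i, lebesgue_outer_rV (A i) = +oo).
  rewrite (eseries_pinfty _ _ ioo) ?leey// => k _.
  by rewrite -ltNye (lt_le_trans _ (lebesgue_outer_rV_ge0 _)).
rewrite -forallNE => Aoo.
apply/lee_addgt0Pr => _/posnumP[e].
rewrite (le_trans _ (epsilon_trick _ _ _))//.
pose vol (p : 'rV[R]_m.+1 * 'rV[R]_m.+1) := (box_vol p.1 p.2)%:E.
pose P k s := box_cover (A k) s /\ \sum_(j <oo) vol (s j) <=
  lebesgue_outer_rV (A k) + (e%:num / (2 ^ k.+1)%:R)%:E.
have [G PG] : {G : nat -> nat -> 'rV[R]_m.+1 * 'rV[R]_m.+1 & forall k, P k (G k)}.
  apply: (@choice _ _ P) => k; rewrite /P.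
  have en1 : (0 < e%:num / (2 ^ k.+1)%:R)%R by [].
  have fk : lebesgue_outer_rV (A k) \is a fin_num.
    by rewrite ge0_fin_numE// ltey; apply/eqP/Aoo.
  have [_ [s sA <-] /ltW ?] := lb_ereal_inf_adherent en1 fk.
  by exists s.
have volG_ge0 x : 0 <= (vol \o uncurry G) x.
  by case: x => k j; rewrite lee_fin box_vol_ge0//; exact: (PG k).1.1.
apply: (@le_trans _ _ (\esum_(i in setT) (vol \o uncurry G) i)).
  apply: ereal_inf_lbound => /=.
  have /card_esym/ppcard_eqP[f] := card_nat2.
  exists (uncurry G \o f).
    split => [k|]; first by rewrite /= /uncurry; case: (f k) => i j; exact: (PG i).1.1.
    move=> t [i _] /((PG i).1.2) [j _ Gij].
    by exists (f^-1%FUN (i, j)) => //=; rewrite invK ?inE.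
  rewrite -(esum_pred_image (vol \o uncurry G) _ xpredT) ?[fun=> _]set_true//.
  by rewrite image_eq.
rewrite (_ : esum _ _ = \sum_(i <oo) \sum_(j <oo) vol (G i j)); last first.
  pose J : nat -> set (nat * nat) := fun i => [set (i, j) | j in setT].
  rewrite (_ : setT = \bigcup_k J k); last first.
    by rewrite predeqE => -[a b]; split => // _; exists a => //; exists b.
  rewrite esum_bigcupT /=; last 2 first.
    - apply/trivIsetP => i j _ _ ij.
      rewrite predeqE => -[k l] /=; split => //= -[] [_] _ [<-{k} _].
      by move=> [l' _] [] /esym/eqP; rewrite (negbTE ij).
    - by move=> x; exact: volG_ge0.
  rewrite -(image_id [set: nat]) -fun_true esum_pred_image//; last first.
    by move=> k _; apply: esum_ge0 => x _; exact: volG_ge0.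
  apply: eq_eseriesr => /= j _.
  rewrite -(esum_pred_image (vol \o uncurry G) (pair j) predT)//=; last 2 first.
  - by move=> k _; exact: (volG_ge0 (j, k)).
  - by move=> ? ? _ _; exact: (@can_inj _ _ _ snd).
  by congr esum; rewrite predeqE => -[a b]; split; move=> [i _ <-]; exists i.
apply: lee_lim.
- apply: is_cvg_nneseries => k *.
  by apply: nneseries_ge0 => l *; exact: (volG_ge0 (k, l)).
- by apply: is_cvg_nneseries => k *; apply: adde_ge0.
- by near=> k; apply: lee_sum => i _; exact: (PG i).2.
Unshelve. all: by end_near. Qed.

HB.instance Definition _ := isOuterMeasure.Build R 'rV[R]_m.+1 lebesgue_outer_rV
  lebesgue_outer_rV0 lebesgue_outer_rV_ge0
  le_lebesgue_outer_rV lebesgue_outer_rV_sigma_subadditive.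

(* R^n endowed with the Lebesgue sigma-algebra. *)
Definition lebesgue_rV := caratheodory_type lebesgue_outer_rV.

HB.instance Definition _ := Measurable.on lebesgue_rV.

Definition lebesgue_measure_rV : set lebesgue_rV -> \bar R := lebesgue_outer_rV.

HB.instance Definition _ := isMeasure.Build _ lebesgue_rV R lebesgue_measure_rV
  (@caratheodory_measure0 _ _ lebesgue_outer_rV)
  (@caratheodory_measure_ge0 _ _ lebesgue_outer_rV)
  (@caratheodory_measure_sigma_additive _ _ lebesgue_outer_rV).

End lebesgue_rV.
Arguments lebesgue_rV : clear implicits.
Arguments lebesgue_measure_rV : clear implicits.

(* The space B(R^n, [0, 1]) of actual functions (no quotient by null sets): two
   elements are equal iff they agree at every point. *)
Record unit_mfun (R : realType) (m : nat) := UnitMFun {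
  unit_mfun_val :> 'rV[R]_m.+1 -> R ;
  measurable_unit_mfun :
    measurable_fun [set: lebesgue_rV R m] (unit_mfun_val : lebesgue_rV R m -> R) ;
  unit_mfun_itv : forall x, 0 <= unit_mfun_val x <= 1 }.

Section unit_mfun_metric.
Context {R : realType} {m : nat}.
Local Notation M := (unit_mfun R m).
Implicit Types f g h : M.

HB.instance Definition _ := gen_eqMixin M.
HB.instance Definition _ := gen_choiceMixin M.

Lemma unit_mfun_ext f g : (forall x, f x = g x) -> f = g.
Proof.
case: f g => [f mf f01] [g mg g01] /= /funext fg.
by subst g; congr UnitMFun; exact: Prop_irrelevance.
Qed.

Definition supdist f g : R := sup (range (fun x => `|f x - g x|)).

Lemma has_sup_supdist f g : has_sup (range (fun x => `|f x - g x|)).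
Proof.
split; first by exists `|f 0 - g 0|; exists 0.
exists 1 => _ [x _ <-].
have /andP[f0 f1] := unit_mfun_itv f x; have /andP[g0 g1] := unit_mfun_itv g x.
by rewrite ler_norml; apply/andP; split; lra.
Qed.

Lemma le_supdist f g x : `|f x - g x| <= supdist f g.
Proof. by apply: (sup_upper_bound (has_sup_supdist f g)); exists x. Qed.

Lemma supdist_le f g r : (forall x, `|f x - g x| <= r) -> supdist f g <= r.
Proof.
by move=> fgr; apply: ge_sup => [|_ [x _ <-]//]; exact: (has_sup_supdist f g).1.
Qed.

Let supdistxx f : supdist f f = 0.
Proof.
apply/eqP; rewrite eq_le; apply/andP; split.
  by apply: supdist_le => x; rewrite subrr normr0.
exact: le_trans (le_supdist f f 0).
Qed.

Let supdist_eq0 f g : supdist f g = 0 -> f = g.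
Proof.
move=> fg0; apply: unit_mfun_ext => x; apply/eqP.
by rewrite -subr_eq0 -normr_le0 -fg0 le_supdist.
Qed.

Let supdistC f g : supdist f g = supdist g f.
Proof. by congr sup; apply: eq_imagel => x _; rewrite distrC. Qed.

Let supdist_triangle g f h : supdist f h <= supdist f g + supdist g h.
Proof.
apply: supdist_le => x; rewrite (le_trans (ler_distD (g x) _ _))//.
by rewrite lerD ?le_supdist.
Qed.

HB.instance Definition _ :=
  isMetric.Build R M supdistxx supdist_eq0 supdistC supdist_triangle.

Lemma unit_mfun_cst0_itv (x : 'rV[R]_m.+1) : 0 <= (cst 0 x : R) <= 1.
Proof. by rewrite lexx ler01. Qed.

HB.instance Definition _ := isPointed.Build M
  (UnitMFun (measurable_cst (0 : R)) unit_mfun_cst0_itv).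

Let unit_mfun_complete (F : set_system M) :
  ProperFilter F -> cauchy F -> cvg F.
Proof.
move=> FF /cauchy_ballP Fc.
have dist_lt (f g : M) e x : ball f e g -> `|f x - g x| < e.
  by rewrite ballEmdist; exact: le_lt_trans (le_supdist f g x).
have cvFx x : (fun f : M => f x) @ F --> lim ((fun f : M => f x) @ F).
  apply: cauchy_cvg; apply/cauchy_ballP => e e0; rewrite !near_map2.
  by apply: filterS (Fc _ e0) => -[f g]; exact: dist_lt.
pose l x := lim ((fun f : M => f x) @ F).
have Fl e : 0 < e -> \forall f \near F, forall x, `|(f : M) x - l x| <= e.
  move=> e0; near=> f => x; near F => g.
  rewrite (le_trans (ler_distD (g x) _ _))// [leRHS]splitr lerD// ltW//.
    apply: dist_lt; near: g; near: f; apply: nearP_dep; apply: Fc.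
    by rewrite divr_gt0.
  rewrite distrC; near: g; move/cvgrPdist_lt : (cvFx x); apply.
  by rewrite divr_gt0.
have [u ul] : {u : nat -> M & forall k x, `|u k x - l x| <= k.+1%:R^-1}.
  apply: (@choice _ _ (fun k (f : M) => forall x, `|f x - l x| <= k.+1%:R^-1)) => k.
  by apply: (@filter_ex _ F); exact: Fl.
have ucvg x : u ^~ x @ \oo --> l x.
  apply/cvgrPdist_le => e e0; near=> k; rewrite distrC (le_trans (ul k x))// ltW//.
  by near: k; exact: near_infty_natSinv_lt (PosNum e0).
have ml : measurable_fun [set: lebesgue_rV R m] (l : lebesgue_rV R m -> R).
  apply: (@measurable_fun_cvg _ _ _ _ (fun k => u k : lebesgue_rV R m -> R)).
    by move=> k; exact: measurable_unit_mfun.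
  by move=> x _; exact: ucvg.
have l01 x : 0 <= l x <= 1.
  apply/andP; split.
    apply: (cvgr_to_ge (ucvg x)).
    by near=> k; case/andP: (unit_mfun_itv (u k) x).
  apply: (cvgr_to_le (ucvg x)).
  by near=> k; case/andP: (unit_mfun_itv (u k) x).
apply/cvg_ex; exists (UnitMFun ml l01); apply/cvg_ballP => e e0.
near=> f; rewrite ballEmdist /=.
rewrite (@le_lt_trans _ _ (e / 2))//; last by rewrite ltr_pdivrMr// ltr_pMr// ltr1n.
apply: supdist_le => x /=; rewrite distrC; move: x; near: f; apply: Fl.
by rewrite divr_gt0.
Unshelve. all: by end_near. Qed.

HB.instance Definition _ := Uniform_isComplete.Build M unit_mfun_complete.

End unit_mfun_metric.

Section arc_field.
Context {R : realType} {M : metricType R}.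
Implicit Types (X F : M -> R -> M).

(* Arc fields and forward flows are represented by total functions of the time;
   their values outside of [0, 1], resp. [0, +oo[, are unconstrained. *)
Definition arc_field X :=
  {within [set: M] `*` `[0, 1]%classic, continuous (fun p : M * R => X p.1 p.2)} /\
  forall f, X f 0 = f.

(* delta <= 1 keeps t in the domain of X. *)
Definition condition_E1 X :=
  forall f0 : M, exists r delta Lambda : R,
    [/\ 0 < r, 0 < delta, delta <= 1 &
      forall f g t, ball f0 r f -> ball f0 r g -> 0 <= t < delta ->
        mdist (X f t) (X g t) <= (1 + t * Lambda) * mdist f g].

(* delta <= 2^-1 amounts to s + t <= 1 for all 0 <= t <= s < delta. *)
Definition condition_E2 X :=
  forall f0 : M, exists r delta Omega : R,
    [/\ 0 < r, 0 < delta, delta <= 2^-1 &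
      forall f s t, ball f0 r f -> 0 <= t -> t <= s -> s < delta ->
        mdist (X f (s + t)) (X (X f s) t) <= s * t * Omega].

Definition forward_flow F :=
  [/\ {within [set: M] `*` `[0, +oo[%classic,
        continuous (fun p : M * R => F p.1 p.2)},
      forall f, F f 0 = f &
      forall f s t, 0 <= s -> 0 <= t -> F (F f s) t = F f (s + t)].

Definition forward_tangent F X :=
  forall f t, 0 <= t ->
    mdist (F f (t + h)) (X (F f t) h) / h @[h --> 0^'+] --> (0 : R).

(* t / N is in the domain [0, 1] of X only for N >= t, which is enough to
   consider the limit N --> oo. *)
Definition euler_curve X f t N : M := iter N (fun g => X g (t / N%:R)) f.

End arc_field.

Definition clip {R : realType} (a b x : R) : R := Num.min (Num.max a x) b.

Definition convolution {R : realType} {m : nat} (K f : 'rV[R]_m.+1 -> R)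
    (x : 'rV[R]_m.+1) : R :=
  \int[lebesgue_measure_rV R m]_y (K (x - y) * f y).

(* Main.v *)
(* Under global one-sided estimates
     d(X_t f, X_t g) <= (1 + L t) d(f, g),  d(X_(s+t) f, X_t (X_s f)) <= W s t,
     d(X_s f, X_t f) <= C |s - t|,
   replacing one step of size h by k steps of size h / k costs O(h^2), so by
   discrete Gronwall the Euler curves with N and N k steps over [0, t] differ by
   O(1 / N) and converge.  The limit F inherits Lipschitz bounds and
   F_(n t) = (F_t)^n, hence F_(s+t) = F_t o F_s by density of the common
   multiples of 1 / N; passing to the limit in the one-step estimate gives
   d(F_h f, X_h f) = O(h^2), i.e. tangency.  Two tangent flows coincide because
   their distance satisfies a Dini differential inequality.

   For the Lenia field these estimates are pointwise consequences of
   |K * f - K * g| <= |K|_1 d(f, g) and of the fact that clipping is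
   1-Lipschitz and can be done in two steps when both increments have the same
   sign.  That X_t f is measurable needs measurability of K * f: if A has finite
   measure, then the measure of A \ (A + h) tends to 0 with h (true for boxes,
   then by approximation), so 1_A * f is continuous; the general case follows by
   approximating K in L^1 by simple functions. *)
Require Import Defs.
From HB Require Import structures.
From mathcomp Require Import all_boot all_order all_algebra.
From mathcomp Require Import all_classical all_reals all_analysis.
From mathcomp Require Import measurable_realfun ring lra.
Set Implicit Arguments.
Unset Strict Implicit.
Unset Printing Implicit Defensive.
Import Order.TTheory GRing.Theory Num.Theory.
Import numFieldNormedType.Exports.

Local Open Scope classical_set_scope.
Local Open Scope ring_scope.

(** * Flows generated by arc fields *)

(** Since [1 + a <= expR a], each of the [n] errors [c] is amplified by at most [expR (a * n%:R)].
    The recursion is asked only for [j < n], which allows a [c] that depends on [n], as in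
    [step_iter_le]. *)
Lemma discrete_gronwall (R : realType) (e : nat -> R) (a c : R) n :
  0 <= a -> 0 <= c -> e 0 <= 0 ->
  (forall j, (j < n)%N -> e j.+1 <= (1 + a) * e j + c) ->
  e n <= n%:R * c * expR (a * n%:R).
Proof.
move=> a0 c0 e0; elim: n => [|n IH] en; first by rewrite !mul0r.
apply: le_trans (en n _) _ => //.
have {}IH : e n <= n%:R * c * expR (a * n%:R).
  by apply: IH => j jn; apply: en; exact: ltnW.
have a1 : 0 <= 1 + a by rewrite addr_ge0.
rewrite (le_trans (lerD (ler_wpM2l a1 IH) (lexx c)))//.
have E1 : 1 + a <= expR a by exact: expR_ge1Dx.
have En : 1 <= expR (a * n%:R) by rewrite -expR0 ler_expR mulr_ge0.
rewrite -natr1 mulrDr mulr1 expRD.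
have nc0 : 0 <= n%:R * c by rewrite mulr_ge0.
have P1 : (1 + a) * (n%:R * c * expR (a * n%:R)) <=
    n%:R * c * (expR (a * n%:R) * expR a).
  by rewrite mulrCA ler_wpM2l// mulrC ler_wpM2l// expR_ge0.
have P2 : c <= c * (expR (a * n%:R) * expR a).
  rewrite ler_peMr// (le_trans En)// ler_peMr ?expR_ge0//.
  by rewrite (le_trans _ E1)// lerDl.
lra.
Qed.

(** * Limits and continuity in a metric space *)

Section metric_limits.
Import metricType_numDomainType.
Context {R : realType} {M : metricType R}.

Lemma cvg_mdist_le (u v : nat -> M) (l l' : M) (b : R) :
  u @ \oo --> l -> v @ \oo --> l' ->
  (\forall n \near \oo, mdist (u n) (v n) <= b) -> mdist l l' <= b.
Proof.
move=> /cvgrPdist_le ul /cvgrPdist_le vl uv.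
apply/ler_addgt0Pr => e e0; have e2 : 0 < e / 2 by rewrite divr_gt0.
near \oo => n.
have A : mdist l (u n) <= e / 2 by near: n; exact: ul.
have B : mdist l' (v n) <= e / 2 by near: n; exact: vl.
have D : mdist (u n) (v n) <= b by near: n.
rewrite (le_trans (metric_triangle _ (u n) _))//.
have := metric_triangle (u n) (v n) l'; rewrite [mdist (v n) l']metric_sym; lra.
Unshelve. all: by end_near. Qed.

Lemma cvg_mdist_rate (u : nat -> M) (l : M) (a : R) :
  (forall n, (0 < n)%N -> mdist l (u n) <= a / n%:R) -> u @ \oo --> l.
Proof.
move=> ul; apply/cvgrPdist_le => e e0; near=> n.
have n0 : (0 < n)%N by near: n; exact: nbhs_infty_gt.
rewrite (le_trans (ul _ n0))// ler_pdivrMr ?ltr0n// mulrC -ler_pdivrMr//.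
by near: n; exact: nbhs_infty_ger.
Unshelve. all: by end_near. Qed.

(** The constant may depend on the base point [(f, t)]: the one for the flow grows with [t]. *)
Lemma lip_within_continuous (phi : M -> R -> M) (D : set R) :
  (forall f t, D t -> exists c : R, forall g s, `|t - s| < 1 -> D s ->
     mdist (phi f t) (phi g s) <= c * (mdist f g + `|t - s|)) ->
  {within [set: M] `*` D, continuous (fun p : M * R => phi p.1 p.2)}.
Proof.
move=> H; apply/subspace_continuousP => -[f t] [_ /= Dt].
have [c cP] := H f t Dt.
apply/cvgrPdist_le => e e0.
have c1 : 0 < `|c| + 1 by rewrite ltr_wpDl.
pose d : R := Num.min 1 (e / (`|c| + 1) / 2).
have d0 : 0 < d by rewrite lt_min ltr01 !divr_gt0.
exists (ball f d, ball t d).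
  by split; apply: nbhsx_ballx.
move=> [g s] [/= fg ts] [_ Ds].
rewrite (le_trans (cP g s _ Ds))//.
  by apply: (lt_le_trans ts); rewrite /d ge_min lexx.
have fg' : mdist f g <= e / (`|c| + 1) / 2.
  move: fg; rewrite ballEmdist => /ltW/le_trans; apply.
  by rewrite /d ge_min lexx orbT.
have ts' : `|t - s| <= e / (`|c| + 1) / 2.
  by rewrite (le_trans (ltW ts))// /d ge_min lexx orbT.
have eE : e = (`|c| + 1) * (e / (`|c| + 1)).
  by rewrite mulrCA mulfV ?mulr1 ?gt_eqF.
rewrite [leRHS]eE.
have ge0 : 0 <= mdist f g + `|t - s| by rewrite addr_ge0// mdist_ge0.
apply: (@le_trans _ _ ((`|c| + 1) * (mdist f g + `|t - s|))).
  by apply: ler_wpM2r => //; apply: (le_trans (ler_norm c)); rewrite lerDl.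
by rewrite ler_wpM2l ?(ltW c1)// [leRHS]splitr lerD.
Qed.

End metric_limits.

(** * Euler curves under global estimates *)

Section iterated_arcs.
Import metricType_numDomainType.
Context {R : realType} {M : metricType R} (X : M -> R -> M) (L W C : R).
Hypotheses (L_ge0 : 0 <= L) (W_ge0 : 0 <= W) (C_ge0 : 0 <= C).
Hypothesis X0 : forall f, X f 0 = f.
Hypothesis X_lip : forall f g (t : R), 0 <= t ->
  mdist (X f t) (X g t) <= (1 + t * L) * mdist f g.
Hypothesis X_semi : forall f (s t : R), 0 <= s -> 0 <= t ->
  mdist (X f (s + t)) (X (X f s) t) <= s * t * W.
Hypothesis X_time : forall f s t, mdist (X f s) (X f t) <= C * `|s - t|.

Local Notation step h := (fun g => X g h).

Lemma iter_step_lip h n f g : 0 <= h ->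
  mdist (iter n (step h) f) (iter n (step h) g) <= expR (h * L * n%:R) * mdist f g.
Proof.
move=> h0; elim: n => [|n IH]; first by rewrite mulr0 expR0 mul1r.
rewrite !iterS (le_trans (X_lip _ _ h0))//.
have hL : 0 <= 1 + h * L by rewrite addr_ge0// mulr_ge0.
rewrite (le_trans (ler_wpM2l hL IH))// -natr1 mulrDr mulr1 expRD mulrA.
rewrite ler_wpM2r ?mdist_ge0// mulrC ler_wpM2l ?expR_ge0//.
exact: expR_ge1Dx.
Qed.

Lemma iter_step_time a b n f : 0 <= a -> 0 <= b ->
  mdist (iter n (step a) f) (iter n (step b) f) <=
    n%:R * (C * `|a - b|) * expR (b * L * n%:R).
Proof.
move=> a0 b0.
pose e n := mdist (iter n (step a) f) (iter n (step b) f).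
apply: (@discrete_gronwall R e); rewrite /e ?mulr_ge0 ?mdistxx// => j _.
rewrite !iterS (le_trans (metric_triangle _ (X (iter j (step a) f) b) _))//.
by rewrite addrC; apply: lerD; [exact: X_lip|exact: X_time].
Qed.

(** Splitting off the step after time [j * d] costs [j * d * d * W], at most [k * d ^+ 2 * W]; [k]
    such errors, amplified, give the square of the total time. *)
Lemma step_iter_le d k f : 0 <= d ->
  mdist (X f (k%:R * d)) (iter k (step d) f) <=
    (k%:R * d) ^+ 2 * W * expR (d * L * k%:R).
Proof.
move=> d0.
pose e k := mdist (X f (k%:R * d)) (iter k (step d) f).
have c0 : 0 <= k%:R * d ^+ 2 * W by rewrite !mulr_ge0// exprn_ge0.
rewrite [X in X * expR _](_ : _ = k%:R * (k%:R * d ^+ 2 * W)); last by ring.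
apply: (@discrete_gronwall R e); rewrite /e ?mul0r ?X0 ?mdistxx ?mulr_ge0// => j jk.
rewrite iterS -natr1 mulrDl mul1r.
rewrite (le_trans (metric_triangle _ (X (X f (j%:R * d)) d) _))//.
rewrite addrC lerD ?X_lip// (le_trans (X_semi _ _ _))// ?mulr_ge0//.
rewrite -[_ * d * d]mulrA -expr2 ler_wpM2r// ler_wpM2r ?exprn_ge0// ler_nat.
exact: ltnW.
Qed.

(** Each of the [N] arcs of length [h] is replaced by [k] arcs of length [h / k], at the local cost
    given by [step_iter_le]. *)
Lemma iter_step_refine h N k f : 0 <= h -> (0 < k)%N ->
  mdist (iter N (step h) f) (iter (N * k) (step (h / k%:R)) f) <=
    N%:R * (h ^+ 2 * W * expR (h * L)) * expR (h * L * N%:R).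
Proof.
move=> h0 k0.
pose e n := mdist (iter n (step h) f) (iter (n * k) (step (h / k%:R)) f).
apply: (@discrete_gronwall R e); rewrite /e ?mdistxx// ?mulr_ge0 ?expR_ge0 ?exprn_ge0//.
move=> j _; rewrite mulSn iterS iterD.
set u := iter j _ _; set v := iter (j * k) _ _.
rewrite (le_trans (metric_triangle _ (X v h) _))// lerD ?X_lip//.
have kd : k%:R * (h / k%:R) = h by rewrite mulrCA mulfV ?mulr1// pnatr_eq0 -lt0n.
have := @step_iter_le (h / k%:R) k v; rewrite kd.
by rewrite [_ * L * _]mulrAC divfK ?pnatr_eq0 -?lt0n//; apply; rewrite divr_ge0.
Qed.

(** For [h = t / N] the total [N * h ^+ 2] is [t ^+ 2 / N], and [expR (h * L) <= expR (t * L)]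
    because [1 <= N]. *)
Lemma euler_curve_refine t N k f : 0 <= t -> (0 < N)%N -> (0 < k)%N ->
  mdist (euler_curve X f t N) (euler_curve X f t (N * k)) <=
    t ^+ 2 * W * expR (t * L) * expR (t * L) / N%:R.
Proof.
move=> t0 N0 k0; rewrite /euler_curve natrM invfM mulrA.
have Npos : 0 < N%:R :> R by rewrite ltr0n.
have tN0 : 0 <= t / N%:R by rewrite divr_ge0.
have tNt : t / N%:R * L * N%:R = t * L by field; rewrite gt_eqF.
rewrite (le_trans (iter_step_refine _ _ _ _))// tNt.
have -> : N%:R * ((t / N%:R) ^+ 2 * W * expR (t / N%:R * L)) * expR (t * L) =
    t ^+ 2 * W * expR (t / N%:R * L) * expR (t * L) / N%:R.
  by field; rewrite gt_eqF.
rewrite ler_wpM2r ?invr_ge0 ?ler0n// ler_wpM2r ?expR_ge0// ler_wpM2l//.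
  by rewrite mulr_ge0// exprn_ge0.
rewrite ler_expR ler_wpM2r// ler_pdivrMr// ler_peMr// ler1n//.
Qed.

(** Both curves are compared with their common refinement in [N * N'] steps. *)
Lemma euler_curve_dist t N N' f : 0 <= t -> (0 < N)%N -> (0 < N')%N ->
  mdist (euler_curve X f t N) (euler_curve X f t N') <=
    t ^+ 2 * W * expR (t * L) * expR (t * L) / N%:R +
    t ^+ 2 * W * expR (t * L) * expR (t * L) / N'%:R.
Proof.
move=> t0 N0 N'0.
rewrite (le_trans (metric_triangle _ (euler_curve X f t (N * N')) _))//.
apply: lerD; first exact: euler_curve_refine.
by rewrite metric_sym mulnC; exact: euler_curve_refine.
Qed.

Hypothesis M_complete : forall u : nat -> M,
  (forall e : R, 0 < e -> exists n0, forall n p, (n0 <= n)%N -> (n0 <= p)%N ->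
     mdist (u n) (u p) <= e) -> exists l : M, u @ \oo --> l.

Lemma euler_curve_cvg f t : 0 <= t -> exists l : M, euler_curve X f t @ \oo --> l.
Proof.
move=> t0; apply: M_complete => e e0.
set K := t ^+ 2 * W * expR (t * L) * expR (t * L).
have K0 : 0 <= K by rewrite !mulr_ge0 ?expR_ge0 ?exprn_ge0.
pose n0 := (Num.truncn (K / e * 2)).+1.
have Kn n : (n0 <= n)%N -> (0 < n)%N /\ K / n%:R <= e / 2.
  move=> n0n; have n_gt0 : (0 < n)%N by exact: leq_trans n0n.
  split=> //; rewrite ler_pdivrMr ?ltr0n// mulrC -ler_pdivrMr ?divr_gt0//.
  rewrite invfM invrK mulrA (le_trans (ltW (Num.Theory.truncnS_gt _)))// ler_nat.
  exact: n0n.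
exists n0 => n p /Kn[n1 Kn1] /Kn[p1 Kp1].
by rewrite (le_trans (euler_curve_dist _ _ _ _))// -/K [leRHS]splitr lerD.
Qed.

(** * The limit of the Euler curves *)

Section euler_limit.
Variable F : M -> R -> M.
Hypothesis F_euler : forall f (t : R), 0 <= t -> euler_curve X f t @ \oo --> F f t.

(** Limit [p --> oo] in [euler_curve_dist]; for [p >= N] the second error term is at most the first,
    whence the factor 2. *)
Lemma euler_limit_rate f t N : 0 <= t -> (0 < N)%N ->
  mdist (euler_curve X f t N) (F f t) <=
    t ^+ 2 * W * expR (t * L) * expR (t * L) * 2 / N%:R.
Proof.
move=> t0 N0; apply: (cvg_mdist_le (cvg_cst _) (@F_euler f t t0)).
near=> p; have Np : (N <= p)%N by near: p; exact: nbhs_infty_ge.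
have p0 : (0 < p)%N by exact: leq_trans Np.
rewrite (le_trans (euler_curve_dist _ t0 N0 p0))//.
rewrite [X in _ <= X / _]mulr_natr mulr2n mulrDl lerD2l ler_wpM2l//.
  by rewrite !mulr_ge0 ?expR_ge0 ?exprn_ge0.
by rewrite lef_pV2 ?posrE ?ltr0n// ler_nat.
Unshelve. all: by end_near. Qed.

Lemma euler_limit_lip f g t : 0 <= t ->
  mdist (F f t) (F g t) <= expR (t * L) * mdist f g.
Proof.
move=> t0; apply: cvg_mdist_le (@F_euler f t t0) (@F_euler g t t0) _.
near=> n; have n0 : (0 < n)%N by near: n; exact: nbhs_infty_gt.
rewrite (le_trans (iter_step_lip _ _ _ _)) ?divr_ge0//.
by rewrite [_ * L * _]mulrAC divfK ?pnatr_eq0 -?lt0n.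
Unshelve. all: by end_near. Qed.

Lemma euler_limit_time f s t : 0 <= s -> 0 <= t ->
  mdist (F f s) (F f t) <= C * `|s - t| * expR (t * L).
Proof.
move=> s0 t0; apply: cvg_mdist_le (@F_euler f s s0) (@F_euler f t t0) _.
near=> n; have n0 : (0 < n)%N by near: n; exact: nbhs_infty_gt.
rewrite (le_trans (iter_step_time _ _ _ _)) ?divr_ge0//.
rewrite [_ * L * _]mulrAC divfK ?pnatr_eq0 -?lt0n//.
rewrite -mulrBl normrM [`|_^-1|]ger0_norm ?invr_ge0//.
rewrite (_ : n%:R * _ = C * `|s - t|)//.
by field; rewrite pnatr_eq0 -lt0n.
Unshelve. all: by end_near. Qed.

(** By [step_iter_le] a single arc of length [h] is this close to its division into [n] arcs,
    uniformly in [n]. The quadratic bound yields tangency. *)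
Lemma euler_limit_local f h : 0 <= h ->
  mdist (X f h) (F f h) <= h ^+ 2 * W * expR (h * L).
Proof.
move=> h0; apply: (cvg_mdist_le (cvg_cst _) (@F_euler f h h0)).
near=> n; have n0 : (0 < n)%N by near: n; exact: nbhs_infty_gt.
have := @step_iter_le (h / n%:R) n f.
have nh : n%:R * (h / n%:R) = h by field; rewrite pnatr_eq0 -lt0n.
by rewrite nh [_ * L * _]mulrAC [h / _ * _]mulrC nh; apply; rewrite divr_ge0.
Unshelve. all: by end_near. Qed.

Lemma euler_limit0 f : F f 0 = f.
Proof.
apply: mdist_positivity; apply/eqP; rewrite eq_le mdist_ge0 andbT metric_sym.
by have := euler_limit_local f (lexx 0); rewrite X0 expr0n !mul0r.
Qed.

(** For [n.+1], the Euler curve with [n.+1 * k] steps over time [n.+1 * t] is the [n.+1]-fold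
    iterate of the one with [k] steps over time [t]. As [k] grows the former tends to the left side
    by the rate above; the latter tends to the right side by induction, the Euler curves being
    Lipschitz in [f] uniformly in [k]. *)
Lemma euler_limit_iter f t n : 0 <= t ->
  F f (n%:R * t) = iter n (fun g => F g t) f.
Proof.
move=> t0; case: n => [|n]; first by rewrite mul0r euler_limit0.
have cvgl : (fun k => euler_curve X f (n.+1%:R * t) (n.+1 * k)) @ \oo -->
    F f (n.+1%:R * t).
  have nt0 : 0 <= n.+1%:R * t by rewrite mulr_ge0.
  set T := n.+1%:R * t.
  apply: (@cvg_mdist_rate _ _ _ _ (T ^+ 2 * W * expR (T * L) * expR (T * L) * 2)).
  move=> k k0; rewrite metric_sym.
  apply: le_trans (euler_limit_rate f nt0 _) _; first by rewrite muln_gt0.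
  rewrite ler_wpM2l ?mulr_ge0 ?expR_ge0 ?exprn_ge0//.
  by rewrite lef_pV2 ?posrE ?ltr0n// ?muln_gt0// ler_nat leq_pmull.
have cvgr : (fun k => iter n.+1 (fun g => euler_curve X g t k) f) @ \oo -->
    iter n.+1 (fun g => F g t) f.
  elim: n.+1 => [|j] /=; first exact: cvg_cst.
  set u := iter j _ f => IH.
  apply/cvgrPdist_le => e e0.
  have B0 : 0 < e / 2 / expR (t * L) by rewrite !divr_gt0// expR_gt0.
  have e2 : 0 < e / 2 by rewrite divr_gt0.
  near=> k; have k0 : (0 < k)%N by near: k; exact: nbhs_infty_gt.
  have uv : mdist u (iter j (fun g => euler_curve X g t k) f) <= e / 2 / expR (t * L).
    by near: k; move/cvgrPdist_le : IH => /(_ _ B0).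
  have uF : mdist (F u t) (euler_curve X u t k) <= e / 2.
    by near: k; move/cvgrPdist_le : (@F_euler u t t0) => /(_ _ e2).
  rewrite (le_trans (metric_triangle _ (euler_curve X u t k) _))//.
  rewrite [leRHS]splitr lerD//.
  rewrite (le_trans (iter_step_lip _ _ _ _)) ?divr_ge0//.
  rewrite [_ * L * _]mulrAC divfK ?pnatr_eq0 -?lt0n//.
  by rewrite mulrC -ler_pdivlMr// expR_gt0.
apply: mdist_positivity; apply/eqP; rewrite eq_le mdist_ge0 andbT.
apply: (cvg_mdist_le cvgl cvgr); near=> k.
have k0 : (0 < k)%N by near: k; exact: nbhs_infty_gt.
rewrite /euler_curve iterM (_ : n.+1%:R * t / (n.+1 * k)%:R = t / k%:R) ?mdistxx//.
by rewrite natrM; field; rewrite pnatr_eq0 -lt0n k0 addrC natr1 pnatr_eq0.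
Unshelve. all: by end_near. Qed.

(** For multiples of [1 / N] both sides are iterates of the flow over time [1 / N]. General [s] and
    [t] are within [1 / N] of such multiples, and the Lipschitz bounds in [f] and in time turn this
    into an error of order [1 / N]. *)
Lemma euler_limit_semigroup f s t : 0 <= s -> 0 <= t ->
  F (F f s) t = F f (s + t).
Proof.
move=> s0 t0; set E := expR ((s + t) * L).
have E1 : 1 <= E by rewrite -expR0 ler_expR mulr_ge0// addr_ge0.
have E0 : 0 <= E by exact: expR_ge0.
(* The three summands are the constants of [H1], [H2] and [H3] below. *)
pose a := C * 2 * E + E * (C * E) + C * E.
suff H N : (0 < N)%N -> mdist (F f (s + t)) (F (F f s) t) <= a / N%:R.
  (* By [H] a constant sequence tends to [F f (s + t)], so its value is that limit. *)
  have := cvg_mdist_rate H => /(@cvg_mdist_le _ _ _ _ _ _ 0 (cvg_cst (F (F f s) t))) H0.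
  apply: mdist_positivity; apply/eqP; rewrite eq_le mdist_ge0 andbT H0//.
  by near=> n; rewrite mdistxx.
move=> N0; have NR : 0 < N%:R :> R by rewrite ltr0n.
have NV : 0 <= N%:R^-1 :> R by rewrite invr_ge0 ltW.
have approx (r : R) : 0 <= r -> exists p : nat, p%:R / N%:R <= r < p%:R / N%:R + N%:R^-1.
  move=> r0; exists (Num.truncn (r * N%:R)).
  have /truncn_itv : 0 <= r * N%:R by rewrite mulr_ge0// ltW.
  move=> /andP[h1 h2]; rewrite ler_pdivrMr// h1/=.
  by rewrite -[X in _ + X]div1r -mulrDl ltr_pdivlMr// natr1.
have [p /andP[ps sp]] := approx s s0.
have [q /andP[qt tq]] := approx t t0.
have pN : 0 <= p%:R / N%:R :> R by rewrite divr_ge0.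
have qN : 0 <= q%:R / N%:R :> R by rewrite divr_ge0.
have pqE : F f ((p%:R + q%:R) / N%:R) = F (F f (p%:R / N%:R)) (q%:R / N%:R).
  rewrite -natrD addnC !euler_limit_iter ?iterD//.
have H1 : mdist (F f (s + t)) (F f ((p%:R + q%:R) / N%:R)) <= C * 2 * E / N%:R.
  have pqN : 0 <= (p%:R + q%:R) / N%:R :> R by rewrite mulrDl addr_ge0.
  rewrite metric_sym (le_trans (euler_limit_time _ pqN (addr_ge0 s0 t0)))//.
  rewrite -/E [leRHS]mulrAC ler_wpM2r// -mulrA ler_wpM2l//.
  by rewrite ler_norml; apply/andP; split; lra.
have H2 : mdist (F (F f (p%:R / N%:R)) (q%:R / N%:R)) (F (F f s) (q%:R / N%:R))
    <= E * (C * E) / N%:R.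
  rewrite (le_trans (euler_limit_lip _ _ _))// -mulrA ler_pM ?expR_ge0 ?mdist_ge0//.
    by rewrite ler_expR ler_wpM2r//; lra.
  rewrite (le_trans (euler_limit_time _ _ _))// mulrAC ler_pM ?mulr_ge0 ?expR_ge0//.
    by rewrite ler_wpM2l// ler_expR ler_wpM2r//; lra.
  by rewrite ler_norml; apply/andP; split; lra.
have H3 : mdist (F (F f s) (q%:R / N%:R)) (F (F f s) t) <= C * E / N%:R.
  rewrite (le_trans (euler_limit_time _ _ _))// mulrAC ler_pM ?mulr_ge0 ?expR_ge0//.
    by rewrite ler_wpM2l// ler_expR ler_wpM2r//; lra.
  by rewrite ler_norml; apply/andP; split; lra.
rewrite (le_trans (metric_triangle _ (F f ((p%:R + q%:R) / N%:R)) _))//.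
rewrite [a / _]mulrDl [in leRHS]mulrDl -addrA lerD// pqE.
rewrite (le_trans (metric_triangle _ (F (F f s) (q%:R / N%:R)) _))//.
exact: lerD.
Unshelve. all: by end_near. Qed.

End euler_limit.

End iterated_arcs.

(* Comparison with [b t = e' * t * expR (t * L)]: at the infimum of the times
   where [b < g], continuity and the one-sided estimate contradict each other. *)
Lemma dini_gronwall (R : realType) (g : R -> R) (L : R) : 0 <= L -> g 0 <= 0 ->
  {within `[0, +oo[, continuous g} ->
  (forall t e : R, 0 <= t -> 0 < e ->
     \forall h \near 0^'+, g (t + h) <= (1 + h * L) * g t + e * h) ->
  forall t : R, 0 <= t -> g t <= 0.
Proof.
move=> L0 g0 gcont gstep t t0; apply/ler_addgt0Pr => e e0; rewrite add0r.
have E0 := expR_ge0 (t * L).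
have tE0 : 0 <= t * expR (t * L) by rewrite mulr_ge0.
have tE1 : 0 < t * expR (t * L) + 1 by rewrite ltr_wpDl.
(* Chosen so that [b t <= e]; the added 1 keeps the divisor positive at [t = 0]. *)
pose e' := e / (t * expR (t * L) + 1).
have e'0 : 0 < e' by rewrite divr_gt0.
pose b s := e' * (s * expR (s * L)).
suff : g t <= b t.
  move/le_trans; apply; rewrite /b /e' mulrAC ler_pdivrMr// ler_pM2l//.
  by rewrite lerDl.
have bc : continuous b.
  move=> s; apply: cvgM; first exact: cvg_cst.
  apply: cvgM; first exact: cvg_id.
  apply: continuous_comp; last exact: continuous_expR.
  by apply: cvgM; [exact: cvg_id|exact: cvg_cst].
(* The barrier [b] satisfies the reverse of the one-sided estimate for [g]. *)
have bstep s h : 0 <= s -> 0 <= h -> (1 + h * L) * b s + e' * h <= b (s + h).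
  move=> s0 h0; rewrite /b.
  have hL0 : 0 <= h * L by rewrite mulr_ge0.
  have sL0 : 0 <= s * L by rewrite mulr_ge0.
  have E1 : 1 + h * L <= expR (h * L) by exact: expR_ge1Dx.
  have E2 : 1 <= expR (s * L + h * L) by rewrite -expR0 ler_expR addr_ge0.
  rewrite [(s + h) * expR _]mulrDl mulrDr [(s + h) * L]mulrDl lerD//.
    rewrite expRD mulrCA ler_wpM2l ?(ltW e'0)// mulrCA ler_wpM2l// mulrC.
    by rewrite ler_wpM2l// expR_ge0.
  by rewrite ler_wpM2l ?(ltW e'0)// ler_peMr.
rewrite leNgt; apply/negP => btg.
pose B := [set s | 0 <= s /\ b s < g s].
have infB : has_inf B.
  by split; [exists t|exists 0 => s []].
set c := inf B.
have c0 : 0 <= c by apply: lb_le_inf; [exact: infB.1|move=> s []].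
have ltc s : 0 <= s -> s < c -> g s <= b s.
  move=> s0 sc; rewrite leNgt; apply/negP => bg.
  by move: sc; rewrite ltNge => /negP; apply; apply: ge_inf; [exact: infB.2|].
(* Otherwise [c] is positive, as [g 0 <= b 0], and by continuity [b < g] also holds just to the left
   of [c], against [ltc]. *)
have gbc : g c <= b c.
  rewrite leNgt; apply/negP => bg.
  have c_gt0 : 0 < c.
    rewrite lt_neqAle c0 andbT eq_sym; apply/eqP => cE.
    by move: bg; rewrite cE /b mul0r mulr0 ltNge g0.
  have d0 : 0 < (g c - b c) / 2 by rewrite divr_gt0// subr_gt0.
  have /subspace_continuousP/(_ c) := gcont.
  rewrite /= in_itv/= c0 => /(_ isT)/cvgrPdist_lt/(_ _ d0).
  move=> gnear'.
  have {gnear'}gnear : \forall s \near c, s \in `[0, +oo[ ->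
    `|g c - g s| < (g c - b c) / 2 by exact: gnear'.
  move/cvgrPdist_lt : (bc c) => /(_ _ d0) bnear.
  have [r /= r0 rP] := filterI gnear bnear.
  pose s := c - Num.min r c / 2.
  have m0 : 0 < Num.min r c by rewrite lt_min r0.
  have mr : Num.min r c <= r by rewrite ge_min lexx.
  have mc : Num.min r c <= c by rewrite ge_min lexx orbT.
  have s0 : 0 <= s by rewrite /s; lra.
  have sc : s < c by rewrite /s; lra.
  have [] := rP s.
    by rewrite /ball/= ltr_norml; apply/andP; split; rewrite /s; lra.
  rewrite in_itv/= s0 => /(_ isT); rewrite !ltr_norml => /andP[_ h1] /andP[h2 _].
  by have := ltc _ s0 sc; lra.
(* The estimate started at [c] gives [g <= b] on a right neighbourhood of [c], where the infimum
   property nevertheless provides a point of [B]. *)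
have [d /= d0 dP] := gstep _ _ c0 e'0.
have [s [s0 bs] sd] : exists2 s, B s & s < c + d.
  by have [s Bs sd] := inf_adherent d0 infB; exists s.
have cs : c < s.
  rewrite lt_neqAle; apply/andP; split.
    by apply/eqP => cE; move: bs; rewrite -cE ltNge gbc.
  by apply: ge_inf; [exact: infB.2|].
have := dP (s - c); rewrite /ball/= sub0r normrN gtr0_norm ?subr_gt0//.
have -> : s - c < d by lra.
move=> /(_ isT cs); rewrite [c + _]addrC subrK; move: bs; rewrite ltNge => /negP bs gs.
apply: bs; apply: (le_trans gs).
have sc0 : 0 <= s - c by rewrite subr_ge0 ltW.
have := bstep c _ c0 sc0; rewrite [c + _]addrC subrK; apply: le_trans.
rewrite lerD2r ler_wpM2l//.
by rewrite addr_ge0// mulr_ge0.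
Qed.

(** * Existence and uniqueness of the tangent flow *)

Section flow.
Import metricType_numDomainType.
Context {R : realType} {M : metricType R}.
Implicit Types (X F : M -> R -> M).

Lemma forward_flow_continuous F f :
  {within [set: M] `*` `[0, +oo[%classic, continuous (fun p : M * R => F p.1 p.2)} ->
  forall t e : R, 0 <= t -> 0 < e ->
    \forall s \near t, 0 <= s -> mdist (F f t) (F f s) <= e.
Proof.
move=> /subspace_continuousP Fc t e t0 e0.
have tD : ([set: M] `*` `[0, +oo[%classic) (f, t).
  by split => //=; rewrite in_itv/= t0.
have /cvgrPdist_le/(_ _ e0) [[A B] [/= fA tB] AB] := Fc _ tD.
near=> s => s0; apply: (AB (f, s)); last by split => //=; rewrite in_itv/= s0.
by split => /=; [exact: nbhs_singleton|near: s].
Unshelve. all: by end_near. Qed.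

(** The distance [g] of the two trajectories satisfies [g (s + h) <= (1 + h * L) * g s + e * h] for
    small [h > 0], by the triangle inequality through the two arcs issued at time [s]; then
    [dini_gronwall] applies. *)
Lemma forward_tangent_unique X F F' (L : R) : 0 <= L ->
  (forall f g (t : R), 0 <= t -> mdist (X f t) (X g t) <= (1 + t * L) * mdist f g) ->
  forward_flow F -> forward_tangent F X ->
  forward_flow F' -> forward_tangent F' X ->
  forall f t, 0 <= t -> F' f t = F f t.
Proof.
move=> L0 X_lip [Fc F0 _] FX [F'c F'0 _] F'X f t t0.
pose g s := mdist (F' f s) (F f s).
apply: mdist_positivity; apply/eqP; rewrite eq_le mdist_ge0 andbT -/(g t).
apply: (@dini_gronwall _ _ L) t t0 => //.
- by rewrite /g F0 F'0 mdistxx.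
- apply/subspace_continuousP => s; rewrite /= in_itv/= andbT => s0.
  apply/pseudometric_normed_Zmodule.cvgrPdist_le => e e0; have e2 : 0 < e / 2 by rewrite divr_gt0.
  have := forward_flow_continuous f Fc s0 e2.
  have := forward_flow_continuous f F'c s0 e2.
  move=> H1 H2.
  suff : \forall r \near s, r \in `[0, +oo[ -> `|g s - g r| <= e by [].
  near=> r; rewrite in_itv/= andbT => r0.
  have h1 : mdist (F' f s) (F' f r) <= e / 2 by move: r0; near: r.
  have h2 : mdist (F f s) (F f r) <= e / 2 by move: r0; near: r.
  rewrite ler_norml /g; apply/andP; split.
    have := metric_triangle (F' f r) (F' f s) (F f r).
    have := metric_triangle (F' f s) (F f s) (F f r).
    by rewrite [mdist (F' f r) (F' f s)]metric_sym; lra.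
  have := metric_triangle (F' f s) (F' f r) (F f s).
  have := metric_triangle (F' f r) (F f r) (F f s).
  by rewrite [mdist (F f r) (F f s)]metric_sym; lra.
- move=> s e s0 e0; have e2 : 0 < e / 2 by rewrite divr_gt0.
  have near_tangent F1 : forward_tangent F1 X -> \forall h \near 0^'+,
      mdist (F1 f (s + h)) (X (F1 f s) h) <= e / 2 * h.
    move=> /(_ f s s0)/pseudometric_normed_Zmodule.cvgrPdist_le/(_ _ e2) H; near=> h.
    have h0 : 0 < h by near: h; exact: nbhs_right_gt.
    rewrite -ler_pdivrMr// (le_trans (ler_norm _))//.
    by rewrite -normrN -sub0r; near: h.
  near=> h; have h0 : 0 <= h by near: h; exact: nbhs_right_ge.
  have H1 : mdist (F f (s + h)) (X (F f s) h) <= e / 2 * h.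
    by near: h; exact: near_tangent.
  have H2 : mdist (F' f (s + h)) (X (F' f s) h) <= e / 2 * h.
    by near: h; exact: near_tangent.
  have H3 := X_lip (F' f s) (F f s) _ h0.
  have := metric_triangle (F' f (s + h)) (X (F' f s) h) (F f (s + h)).
  have := metric_triangle (X (F' f s) h) (X (F f s) h) (F f (s + h)).
  rewrite [mdist (X (F f s) h) (F f (s + h))]metric_sym /g; lra.
Unshelve. all: by end_near. Qed.

Lemma arc_field_flow X (L W C : R) : 0 <= L -> 0 <= W -> 0 <= C ->
  (forall f, X f 0 = f) ->
  (forall f g (t : R), 0 <= t -> mdist (X f t) (X g t) <= (1 + t * L) * mdist f g) ->
  (forall f (s t : R), 0 <= s -> 0 <= t ->
    mdist (X f (s + t)) (X (X f s) t) <= s * t * W) ->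
  (forall f s t, mdist (X f s) (X f t) <= C * `|s - t|) ->
  (forall u : nat -> M,
    (forall e : R, 0 < e -> exists n0, forall n p, (n0 <= n)%N -> (n0 <= p)%N ->
       mdist (u n) (u p) <= e) -> exists l : M, u @ \oo --> l) ->
  exists F,
    [/\ forward_flow F, forward_tangent F X,
      forall F', forward_flow F' -> forward_tangent F' X ->
        forall f t, 0 <= t -> F' f t = F f t &
      forall f t, 0 <= t -> euler_curve X f t @ \oo --> F f t].
Proof.
move=> L0 W0 C0 X0 X_lip X_semi X_time M_complete.
have [F' F'E] : {F' : M * R -> M & forall p : M * R, 0 <= p.2 ->
    euler_curve X p.1 p.2 @ \oo --> F' p}.
  apply: (@choice _ _ (fun (p : M * R) l => 0 <= p.2 ->
    euler_curve X p.1 p.2 @ \oo --> l)) => -[f t] /=.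
  (* At negative times [f] serves as a default value. *)
  have [t0|t0] := leP 0 t; last by exists f.
  by have [l ?] := euler_curve_cvg L0 W0 X0 X_lip X_semi M_complete f t0; exists l.
pose F f t := F' (f, t).
have FE f (t : R) : 0 <= t -> euler_curve X f t @ \oo --> F f t by exact: (F'E (f, t)).
have F_semi := euler_limit_semigroup L0 W0 C0 X0 X_lip X_semi X_time FE.
have F_flow : forward_flow F.
  split; last 2 first.
  - exact: (euler_limit0 L0 W0 X0 X_lip X_semi FE).
  - by move=> f s t s0 t0; exact: F_semi.
  apply: lip_within_continuous => f t; rewrite /= in_itv/= andbT => t0.
  (* As [s < t + 1], the first entry bounds the Lipschitz constant in [f] at time [s]; the second is
     the one in time. *)
  exists (Num.max (expR ((t + 1) * L)) (C * expR (t * L))) => g s ts.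
  rewrite in_itv/= andbT => s0.
  rewrite (le_trans (metric_triangle _ (F f s) _))// addrC mulrDr.
  rewrite lerD//.
    rewrite (le_trans (euler_limit_lip L0 X_lip FE _ _ s0))//.
    rewrite ler_wpM2r ?mdist_ge0// le_max ler_expR ler_wpM2r//.
    by move: ts; rewrite ltr_norml => /andP[h1 h2]; lra.
  rewrite metric_sym distrC (le_trans (euler_limit_time L0 C0 X_lip X_time FE _ s0 t0))//.
  by rewrite mulrAC ler_wpM2r// le_max lexx orbT.
have F_tangent : forward_tangent F X.
  move=> f t t0; apply/pseudometric_normed_Zmodule.cvgrPdist_le => e e0; near=> h.
  have h0 : 0 < h by near: h; exact: nbhs_right_gt.
  have h1 : h <= 1 by near: h; exact: nbhs_right_le.
  (* For [h <= 1] the quotient is at most [h * (W * expR L)], hence at most [e]. *)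
  have he : h <= e / (W * expR L + 1).
    by near: h; apply: nbhs_right_le; rewrite divr_gt0// ltr_wpDl// mulr_ge0// expR_ge0.
  rewrite sub0r normrN ger0_norm ?divr_ge0 ?mdist_ge0 ?(ltW h0)//.
  rewrite ler_pdivrMr// metric_sym -F_semi ?(ltW h0)//.
  rewrite (le_trans (euler_limit_local L0 W0 X0 X_lip X_semi FE _ (ltW h0)))//.
  have WE : 0 < W * expR L + 1 by rewrite ltr_wpDl// mulr_ge0// expR_ge0.
  rewrite (_ : h ^+ 2 * W * _ = h * (W * expR (h * L)) * h); last by ring.
  rewrite ler_wpM2r ?(ltW h0)//; move: he; rewrite ler_pdivlMr//; apply: le_trans.
  rewrite ler_wpM2l ?(ltW h0)// ler_wpDr// ler_wpM2l// ler_expR.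
  by rewrite ler_piMl.
exists F; split => //.
by move=> G Gf Gt f t t0; exact: (forward_tangent_unique L0 X_lip).
Unshelve. all: by end_near. Qed.

End flow.

(** * Lebesgue measure and convolution on R^n *)

(** The pushforward of [mu] along [phi] is [mu] itself. *)
Lemma ge0_integral_preserving d (T : measurableType d) (R : realType)
    (mu : {measure set T -> \bar R}) (phi : T -> T) (g : T -> \bar R) :
  measurable_fun setT phi -> (forall A, measurable A -> mu (phi @^-1` A) = mu A) ->
  measurable_fun setT g -> (forall y, (0 <= g y)%E) ->
  (\int[mu]_y g (phi y) = \int[mu]_y g y)%E.
Proof.
move=> mphi phiE mg g0; transitivity (\int[pushforward mu phi]_y g y)%E.
  by rewrite ge0_integral_pushforward.
by apply: eq_measure_integral => //= A mA _; rewrite -phiE.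
Qed.

Lemma integrable_preserving d (T : measurableType d) (R : realType)
    (mu : {measure set T -> \bar R}) (phi : T -> T) (g : T -> \bar R) :
  measurable_fun setT phi -> (forall A, measurable A -> mu (phi @^-1` A) = mu A) ->
  mu.-integrable setT g -> mu.-integrable setT (g \o phi).
Proof.
move=> mphi phiE /integrableP[mg goo]; apply/integrableP; split.
  exact: measurableT_comp.
rewrite (@ge0_integral_preserving _ _ _ mu phi (fun y => `|g y|%E))//.
exact: measurableT_comp.
Qed.

(** * Integrals of an integrable kernel against bounded functions *)

Section bounded_kernel.
Context d (T : measurableType d) (R : realType) (mu : {measure set T -> \bar R}).
Implicit Types k f : T -> R.

Lemma integrable_mul_bounded k f :
  mu.-integrable setT (EFin \o k) -> measurable_fun setT f ->
  (forall y, `|f y| <= 1) -> mu.-integrable setT (EFin \o (fun y => k y * f y)).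
Proof.
move=> ik mf f1; have mk : measurable_fun setT k.
  by apply/measurable_EFinP; exact: measurable_int ik.
apply: le_integrable ik => //.
  by apply/measurable_EFinP; exact: measurable_funM.
by move=> y _; rewrite /= lee_fin normrM ler_piMr.
Qed.

Lemma Rintegral_mul_bounded_dist k k' f :
  mu.-integrable setT (EFin \o k) -> mu.-integrable setT (EFin \o k') ->
  measurable_fun setT f -> (forall y, `|f y| <= 1) ->
  (`|(\int[mu]_y (k y * f y)) - (\int[mu]_y (k' y * f y))|%R%:E <=
    \int[mu]_y `|k y - k' y|%:E)%E.
Proof.
move=> ik ik' mf f1.
have i1 := integrable_mul_bounded ik mf f1.
have i2 := integrable_mul_bounded ik' mf f1.
rewrite -RintegralB// EFin_normr_Rintegral//; last exact: (integrableB _ i1 i2).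
have mB : measurable_fun setT (fun y => k y * f y - k' y * f y).
  by apply/measurable_EFinP; exact: measurable_int (integrableB _ i1 i2).
apply: le_trans (le_abse_integral _ _ _) _ => //; first exact/measurable_EFinP.
apply: ge0_le_integral => //=.
- by apply/measurable_EFinP; exact: measurableT_comp.
- move: (measurable_int _ ik) => /measurable_EFinP m1.
  move: (measurable_int _ ik') => /measurable_EFinP m2.
  by apply/measurable_EFinP; apply: measurableT_comp => //; exact: measurable_funB.
- by move=> y _; rewrite lee_fin -mulrBl normrM ler_piMr.
Qed.

(** The indicator of the level set is dominated by the integrable function [r^-1 * k], which is 1 on
    that set. *)
Lemma integrable_preimage_lty k (r : R) : r != 0 -> measurable_fun setT k ->
  mu.-integrable setT (EFin \o k) -> (mu (k @^-1` [set r]) < +oo)%E.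
Proof.
move=> r0 mk ik; pose A := k @^-1` [set r].
have mA : measurable A by rewrite -[A]setTI; exact: mk.
have : mu.-integrable setT (EFin \o (\1_A : T -> R)).
  apply: le_integrable (integrableZl measurableT r^-1 ik) => //.
    by apply/measurable_EFinP; exact: measurable_indic.
  move=> y _; rewrite /= lee_fin indicE; have [yA|_] := boolP (y \in A).
    by have := set_mem yA; rewrite /A/= => ->; rewrite mulVf.
  by rewrite normr0.
move=> /integrableP[_]; rewrite (eq_integral (EFin \o (\1_A : T -> R))).
  by rewrite integral_indic// setIT.
by move=> y _; rewrite /= ger0_norm.
Qed.

Lemma integrable_measurable_norm k : mu.-integrable setT (EFin \o k) ->
  measurable_fun setT (fun y => `|k y|%:E).
Proof.
move=> ik; apply/measurable_EFinP; apply: measurableT_comp => //.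
by apply/measurable_EFinP; exact: measurable_int ik.
Qed.

Lemma Rintegral_mul_boundedD k k' f :
  mu.-integrable setT (EFin \o k) -> mu.-integrable setT (EFin \o k') ->
  measurable_fun setT f -> (forall y, `|f y| <= 1) ->
  \int[mu]_y ((k y + k' y) * f y) =
  \int[mu]_y (k y * f y) + \int[mu]_y (k' y * f y).
Proof.
move=> ik ik' mf f1; under eq_Rintegral do rewrite mulrDl.
by rewrite RintegralD//; exact: integrable_mul_bounded.
Qed.

Lemma Rintegral_mul_boundedZ (c : R) k f :
  mu.-integrable setT (EFin \o k) -> measurable_fun setT f ->
  (forall y, `|f y| <= 1) ->
  \int[mu]_y (c * k y * f y) = c * \int[mu]_y (k y * f y).
Proof.
move=> ik mf f1; under eq_Rintegral do rewrite -mulrA.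
by rewrite RintegralZl//; exact: integrable_mul_bounded.
Qed.

Lemma Rintegral_mul_le k f f' (c : R) :
  mu.-integrable setT (EFin \o k) ->
  measurable_fun setT f -> (forall y, `|f y| <= 1) ->
  measurable_fun setT f' -> (forall y, `|f' y| <= 1) ->
  (forall y, `|f y - f' y| <= c) -> 0 <= c ->
  (`|(\int[mu]_y (k y * f y)) - (\int[mu]_y (k y * f' y))|%R%:E <=
    c%:E * \int[mu]_y `|k y|%:E)%E.
Proof.
move=> ik mf f1 mf' f1' ff' c0.
have i1 := integrable_mul_bounded ik mf f1.
have i2 := integrable_mul_bounded ik mf' f1'.
rewrite -RintegralB// EFin_normr_Rintegral//; last exact: (integrableB _ i1 i2).
have mB : measurable_fun setT (fun y => k y * f y - k y * f' y).
  by apply/measurable_EFinP; exact: measurable_int (integrableB _ i1 i2).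
apply: le_trans (le_abse_integral _ _ _) _ => //; first exact/measurable_EFinP.
have mnk := integrable_measurable_norm ik.
rewrite -ge0_integralZl_EFin//.
apply: ge0_le_integral => //=.
- by apply/measurable_EFinP; exact: measurableT_comp.
- exact: measurable_funeM.
- by move=> y _; rewrite lee_fin -mulrBr normrM mulrC ler_wpM2r.
Qed.

End bounded_kernel.

Lemma integrable_indicT d (T : measurableType d) (R : realType)
    (mu : {measure set T -> \bar R}) (A : set T) : measurable A ->
  (mu A < +oo)%E -> mu.-integrable setT (EFin \o (\1_A : T -> R)).
Proof.
move=> mA Aoo.
apply/integrableP; split; first by apply/measurable_EFinP; exact: measurable_indic.
rewrite (eq_integral (EFin \o (\1_A : T -> R))).
  by rewrite integral_indic// setIT.
by move=> y _; rewrite /= ger0_norm.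
Qed.

(** The integrand is the indicator of the symmetric difference. *)
Lemma le_integral_indicB d (T : measurableType d) (R : realType)
    (mu : {measure set T -> \bar R}) (B B' : set T) :
  measurable B -> measurable B' ->
  (\int[mu]_y `|(\1_B y - \1_B' y : R)|%:E <= mu (B `\` B') + mu (B' `\` B))%E.
Proof.
move=> mB mB'.
have mD : measurable (B `\` B') by exact: measurableD.
have mD' : measurable (B' `\` B) by exact: measurableD.
rewrite -[X in mu X + _]setIT -[X in _ + mu X]setIT -!integral_indic//.
rewrite -ge0_integralD//; last 2 first.
- by apply/measurable_EFinP; exact: measurable_indic.
- by apply/measurable_EFinP; exact: measurable_indic.
apply: ge0_le_integral => //=.
- apply/measurable_EFinP; apply: measurableT_comp => //.
  by apply: measurable_funB; exact: measurable_indic.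
- apply: emeasurable_funD; apply/measurable_EFinP; exact: measurable_indic.
move=> y _; rewrite -EFinD lee_fin !indicE !in_setD.
by case: (y \in B); case: (y \in B'); rewrite /= ?subrr ?subr0 ?sub0r ?normrN ?normr0 ?normr1 ?addr0 ?add0r.
Qed.

(** * Lebesgue measurable sets and their symmetries *)

Section lebesgue_rV_theory.
Context {R : realType} {m : nat}.
Local Notation V := 'rV[R]_m.+1.
Local Notation T := (lebesgue_rV R m).
Local Notation mu := (lebesgue_measure_rV R m).
Local Notation outer := (@lebesgue_outer_rV R m).
Implicit Types (a b x h : V) (A B : set V).

Lemma lebesgue_outer_rV_le (s : nat -> V * V) A : box_cover A s ->
  (outer A <= \sum_(k <oo) (box_vol (s k).1 (s k).2)%:E)%E.
Proof. by move=> sA; apply: ereal_inf_lbound; exists s. Qed.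

Lemma lebesgue_outer_rV_glb A (z : \bar R) :
  (forall s, box_cover A s -> (z <= \sum_(k <oo) (box_vol (s k).1 (s k).2)%:E)%E) ->
  (z <= outer A)%E.
Proof. by move=> H; apply: le_ereal_inf_tmp => _ [s /H ? <-]. Qed.

Definition set_coord (a : V) (i : 'I_m.+1) (c : R) : V :=
  \row_j (if j == i then c else a 0 j).

(** Only the factor of index [i] changes; it splits as [(c - a 0 i) + (b 0 i - c)], wherever [c]
    lies. *)
Lemma box_vol_split a b i (c : R) :
  box_vol a b = box_vol a (set_coord b i c) + box_vol (set_coord a i c) b.
Proof.
rewrite /box_vol (bigD1 i)//= [X in _ = X + _](bigD1 i)//=.
rewrite [X in _ = _ + X](bigD1 i)//= !mxE eqxx.
rewrite [in X in _ = X + _](eq_bigr (fun j => b 0 j - a 0 j)); last first.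
  by move=> j ji; rewrite !mxE (negbTE ji).
rewrite [in X in _ = _ + X](eq_bigr (fun j => b 0 j - a 0 j)); last first.
  by move=> j ji; rewrite !mxE (negbTE ji).
by rewrite -mulrDl; congr (_ * _); ring.
Qed.

(* A cover by boxes is cut along the hyperplane [x 0 i = c] into covers of the
   two sides, without changing the total volume. *)
Lemma measurable_halfspace (i : 'I_m.+1) (c : R) :
  measurable ([set x | x 0 i <= c] : set T).
Proof.
apply: le_caratheodory_measurable => X; apply: lebesgue_outer_rV_glb => s [sP Xs].
(* Clamping [c] to the side of the box keeps the corners of both pieces ordered, one piece being
   flat if the hyperplane misses the box. *)
pose cut k := Num.min (Num.max ((s k).1 0 i) c) ((s k).2 0 i).
have cutP k : (s k).1 0 i <= cut k <= (s k).2 0 i.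
  by rewrite /cut le_min sP le_max lexx ge_min lexx orbT.
pose s1 k := ((s k).1, set_coord (s k).2 i (cut k)).
pose s2 k := (set_coord (s k).1 i (cut k), (s k).2).
have s1P k j : (s1 k).1 0 j <= (s1 k).2 0 j.
  rewrite !mxE; case: eqP => [->|_]; last exact: sP.
  by case/andP: (cutP k).
have s2P k j : (s2 k).1 0 j <= (s2 k).2 0 j.
  rewrite !mxE; case: eqP => [->|_]; last exact: sP.
  by case/andP: (cutP k).
have C1 : box_cover (X `&` [set x | x 0 i <= c]) s1.
  split=> // x [Xx /= xc]; have [k _ xk] := Xs _ Xx; exists k => // j.
  have /andP[h1 +] := xk j; rewrite h1/= mxE; case: eqP => [->|//] h2.
  by rewrite /cut le_min h2 le_max xc orbT.
have C2 : box_cover (X `&` ~` [set x | x 0 i <= c]) s2.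
  split=> // x [Xx /= /negP]; rewrite -ltNge => xc.
  have [k _ xk] := Xs _ Xx; exists k => // j.
  have /andP[+ h2] := xk j; rewrite h2 andbT/= mxE; case: eqP => [->|//] h1.
  by rewrite /cut ge_min ge_max h1 (ltW xc).
rewrite (le_trans (leeD (lebesgue_outer_rV_le C1) (lebesgue_outer_rV_le C2)))//.
rewrite -nneseriesD; last 2 first.
- by move=> k _ _; rewrite lee_fin box_vol_ge0.
- by move=> k _ _; rewrite lee_fin box_vol_ge0.
rewrite le_eqVlt; apply/orP; left; apply/eqP; apply: eq_eseriesr => k _.
by rewrite -EFinD (box_vol_split (s k).1 (s k).2 i (cut k)).
Qed.

Lemma measurable_coord (i : 'I_m.+1) :
  measurable_fun setT ((fun x : V => x 0 i) : T -> R).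
Proof.
apply: (measurability _ (@RGenInftyO.measurableE R)) => // _ [_ [c ->] <-].
rewrite setTI (_ : _ @^-1` _ =
    \bigcup_n [set x : V | x 0 i <= c - n.+1%:R^-1]); last first.
  apply/seteqP; split => x /=; rewrite in_itv/=.
    by move=> /ltr_add_invr[n nc]; exists n => //=; rewrite lerBrDr ltW.
  by move=> [n _ /= h]; apply: (le_lt_trans h); rewrite ltrBlDr ltrDl invr_gt0.
apply: bigcupT_measurable => n; exact: measurable_halfspace.
Qed.

Lemma measurable_box a b : measurable (box a b : set T).
Proof.
rewrite (_ : box a b = \bigcap_(i in [set: 'I_m.+1])
    ((fun x : V => x 0 i) @^-1` `[a 0 i, b 0 i])); last first.
  apply/seteqP; split => x; first by move=> xab i _; rewrite /= in_itv/=.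
  by move=> xab i; have := xab i I; rewrite /= in_itv.
apply: fin_bigcap_measurable => // i _.
by rewrite -[X in measurable X]setTI; exact: measurable_coord.
Qed.

(** An open set is the union of the boxes with rational corners that it contains, and these are
    countably many. *)
Lemma continuous_measurable_rV (g : V -> R) : continuous g ->
  measurable_fun setT (g : T -> R).
Proof.
move=> cg; apply: (measurability _ (@RGenOpens.measurableE R)) => // _ [_ [a [b ->]] <-].
rewrite setTI; set U := _ @^-1` _.
have oU : open U by apply: open_comp => // x _; exact: cg.
pose Q := [set q : 'rV[rat]_m.+1 * 'rV[rat]_m.+1 |
  box (map_mx ratr q.1) (map_mx ratr q.2) `<=` U].
rewrite (_ : U = \bigcup_(q in Q) box (map_mx ratr q.1) (map_mx ratr q.2)).
  rewrite bigcup_mkcond; apply: countable_bigcupT_measurable => // q.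
  by case: ifP => // _; exact: measurable_box.
apply/seteqP; split => [x Ux|x [q qU]]; last exact: qU.
have [r /= r0 xrU] : nbhs_ball x U.
  by apply/nbhs_ballP; move: oU; rewrite openE; exact.
have [p pP] : {p : 'I_m.+1 -> rat & forall i, x 0 i - r < ratr (p i) < x 0 i}.
  apply: (@choice _ _ (fun i (p : rat) => x 0 i - r < ratr p < x 0 i)) => i.
  have /rat_in_itvoo[p] : x 0 i - r < x 0 i by rewrite ltrBlDr ltrDl.
  by rewrite in_itv; exists p.
have [q qP] : {q : 'I_m.+1 -> rat & forall i, x 0 i < ratr (q i) < x 0 i + r}.
  apply: (@choice _ _ (fun i (p : rat) => x 0 i < ratr p < x 0 i + r)) => i.
  have /rat_in_itvoo[q] : x 0 i < x 0 i + r by rewrite ltrDl.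
  by rewrite in_itv; exists q.
exists (\row_i p i, \row_i q i).
  move=> y xy; apply: xrU; split=> // i j; rewrite ord1 /ball/= ltr_norml.
  have := xy j; rewrite !mxE; have := pP j; have := qP j.
  by move=> /andP[? ?] /andP[? ?] /andP[? ?]; apply/andP; split; lra.
move=> i; rewrite !mxE; have := pP i; have := qP i.
by move=> /andP[/ltW -> _] /andP[_ /ltW ->].
Qed.

(** Reflection exchanges the corners of each box of a cover and keeps its volume, which gives one
    inequality for every set; the other follows because reflection is an involution. *)
Lemma lebesgue_outer_rV_reflect x A : outer [set y | A (x - y)] = outer A.
Proof.
have le B : (outer [set y | B (x - y)%R] <= outer B)%E.
  apply: lebesgue_outer_rV_glb => s [sP Bs].
  pose s' k := (x - (s k).2, x - (s k).1).
  have C : box_cover [set y | B (x - y)] s'.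
    split=> [k i|y /Bs [k _ yk]].
      by rewrite !mxE lerD2l lerN2 sP.
    exists k => // i; have := yk i; rewrite !mxE => /andP[? ?].
    by apply/andP; split; lra.
  rewrite (le_trans (lebesgue_outer_rV_le C))// le_eqVlt; apply/orP; left; apply/eqP.
  apply: eq_eseriesr => k _; congr EFin; apply: eq_bigr => i _.
  by rewrite !mxE; ring.
apply/eqP; rewrite eq_le le/=.
rewrite [X in (outer X <= _)%E](_ : _ = [set y | [set z | A (x - z)] (x - y)]); last first.
  by apply/seteqP; split => y /=; rewrite opprD opprK addNKr.
exact: le.
Qed.

(** A translation is a composition of two reflections. *)
Lemma lebesgue_outer_rV_translate h A : outer [set y | A (y + h)] = outer A.
Proof.
rewrite -(lebesgue_outer_rV_reflect h A).
rewrite -(lebesgue_outer_rV_reflect 0 [set y | A (h - y)]).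
by congr outer; apply/seteqP; split => y /=; rewrite sub0r opprK addrC.
Qed.

(** The Caratheodory identity for [X] is the one of [A] for the reflected test set. *)
Lemma measurable_reflect_set x A : measurable (A : set T) ->
  measurable ([set y | A (x - y)] : set T).
Proof.
move=> mA; suff : outer.-caratheodory [set y | A (x - y)] by [].
have {}mA : outer.-caratheodory A by [].
move=> X; rewrite -(lebesgue_outer_rV_reflect x X) [LHS]mA; congr (_ + _)%E.
  rewrite -(lebesgue_outer_rV_reflect x).
  by congr outer; apply/seteqP; split => y /=; rewrite opprD opprK addNKr.
rewrite -(lebesgue_outer_rV_reflect x).
by congr outer; apply/seteqP; split => y /=; rewrite opprD opprK addNKr.
Qed.

Lemma measurable_reflect x : measurable_fun setT ((fun y : V => x - y) : T -> T).
Proof. by move=> _ A mA; rewrite setTI; exact: measurable_reflect_set. Qed.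

Lemma ge0_integral_reflect x (g : T -> \bar R) : measurable_fun setT g ->
  (forall y, (0 <= g y)%E) -> (\int[mu]_y g (x - y : V)%R = \int[mu]_y g y)%E.
Proof.
apply: (ge0_integral_preserving (measurable_reflect x)) => A _.
exact: lebesgue_outer_rV_reflect.
Qed.

Lemma integrable_reflect x (g : T -> R) : mu.-integrable setT (EFin \o g) ->
  mu.-integrable setT (fun y => (g (x - y : V))%:E).
Proof.
apply: (integrable_preserving (measurable_reflect x)) => A _.
exact: lebesgue_outer_rV_reflect.
Qed.

(** * Continuity of translations in measure *)

Lemma nonincreasing_measure_small (F : (set T)^nat) (e : R) : 0 < e ->
  (mu (F 0%N) < +oo)%E -> (forall n, measurable (F n)) -> nonincreasing_seq F ->
  \bigcap_n F n = set0 -> exists n, (mu (F n) <= e%:E)%E.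
Proof.
move=> e0 F0 mF ndF capF.
have := @nonincreasing_cvg_mu _ _ _ mu F F0 mF; rewrite capF => /(_ measurable0 ndF).
rewrite measure0 => /fine_cvgP[fin /cvgrPdist_le/(_ _ e0) small].
near \oo => n; exists n.
have nfin : mu (F n) \is a fin_num by near: n.
rewrite -(fineK nfin) lee_fin (le_trans (ler_norm _))// -normrN -sub0r.
by near: n.
Unshelve. all: by end_near. Qed.

(** These are the points that translation by [h] moves out of [A]. The symmetric difference with a
    translate is recovered from [h] and [- h] together. *)
Definition shift_diff A h : set V := [set z | A z /\ ~ A (z + h)].

Definition shift_continuous A := forall e : R, 0 < e ->
  \forall h \near (0 : V), (outer (shift_diff A h) <= e%:E)%E.

Lemma lebesgue_outer_rV_box_lty a b : (outer (box a b) < +oo)%E.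
Proof.
have [ab|/existsNP[i /negP]] := pselect (forall i, a 0 i <= b 0 i); last first.
  rewrite -ltNge => ba; rewrite (_ : box a b = set0) ?outer_measure0 ?ltry//.
  apply/seteqP; split=> // x /(_ i) /andP[h1 h2].
  by have := le_lt_trans (le_trans h1 h2) ba; rewrite ltxx.
(* The box itself, followed by one-point boxes of volume 0. *)
pose s k : V * V := if k is 0%N then (a, b) else (0, 0).
have C : box_cover (box a b) s.
  by split=> [[|k] i|x xab]; rewrite /= ?mxE//; exists 0%N.
rewrite (le_lt_trans (lebesgue_outer_rV_le C))//.
rewrite nneseries_recl//; last first.
  by move=> k *; rewrite lee_fin; apply: box_vol_ge0; exact: (C.1 k).
rewrite eseries_cond/= eseries0 ?adde0 ?ltry// => -[|k]//= _ _.
by rewrite /box_vol big_ord_recl subrr mul0r.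
Qed.

(** If [h] has coordinates below [n.+1%:R^-1], a point leaving the box lands in [F n], the shell
    between the box and its enlargement. The shells decrease to the empty set since the box is
    closed, so their measures tend to 0. *)
Lemma shift_continuous_box a b : shift_continuous (box a b).
Proof.
move=> e e0.
pose d n : V := const_mx n.+1%:R^-1.
pose F n : set T := box (a - d n) (b + d n) `\` box a b.
have [n Fn] : exists n, (mu (F n) <= e%:E)%E.
  apply: nonincreasing_measure_small => //.
  - apply: le_lt_trans (lebesgue_outer_rV_box_lty (a - d 0%N) (b + d 0%N)).
    by apply: le_outer_measure => x [].
  - by move=> n; apply: measurableD; exact: measurable_box.
  - apply/nonincreasing_seqP => n; apply/subsetPset => x [xn xab]; split=> // i.
    have := xn i; rewrite /d !mxE => /andP[h1 h2].
    have : n.+2%:R^-1 <= n.+1%:R^-1 :> R by rewrite lef_pV2 ?posrE// ler_nat.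
    move: (n.+2%:R^-1) (n.+1%:R^-1) h1 h2 => p q h1 h2 pq.
    by apply/andP; split; lra.
  - apply/seteqP; split=> // x xF; apply: (xF 0%N I).2 => i.
    apply/andP; split; rewrite leNgt; apply/negP => /ltr_add_invr[k].
      have := (xF k I).1 i; rewrite /d !mxE => /andP[h1 h2].
      by move: (k.+1%:R^-1) h1 h2 => p *; lra.
    have := (xF k I).1 i; rewrite /d !mxE => /andP[h1 h2].
    by move: (k.+1%:R^-1) h1 h2 => p *; lra.
apply/nbhs_ballP; exists n.+1%:R^-1 => /=; first by rewrite invr_gt0.
move=> h [_ hn]; apply: le_trans Fn.
rewrite -[leRHS](lebesgue_outer_rV_translate h).
apply: le_outer_measure => z [zab zh].
split=> // i; have := zab i; have := hn 0 i; rewrite /ball/= /d !mxE ltr_norml.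
by move: (n.+1%:R^-1) => p /andP[? ?] /andP[? ?]; apply/andP; split; lra.
Qed.

Lemma shift_continuous0 : shift_continuous set0.
Proof.
move=> e e0; near=> h; rewrite (_ : shift_diff _ _ = set0).
  by rewrite outer_measure0 lee_fin ltW.
by apply/seteqP; split=> // z [].
Unshelve. all: by end_near. Qed.

Lemma shift_continuousU A B :
  shift_continuous A -> shift_continuous B -> shift_continuous (A `|` B).
Proof.
move=> cA cB e e0; have e2 : 0 < e / 2 by rewrite divr_gt0.
apply: filterS2 (cA _ e2) (cB _ e2) => h hA hB.
rewrite [e]splitr EFinD; apply: le_trans (leeD hA hB).
apply: le_trans (outer_measureU2 _ _ _); apply: le_outer_measure => z [[Az|Bz] /not_orP[]].
  by left.
by right.
Qed.

(** A point [z] of [A] with [z + h] outside [A] is in [A] minus [B], or is moved out of [B], or has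
    [z + h] in [B] minus [A]; the last case has the measure of [B] minus [A] by translation
    invariance. *)
Lemma shift_continuous_approx A :
  (forall e : R, 0 < e -> exists B, [/\ shift_continuous B,
    (outer (A `\` B) <= e%:E)%E & (outer (B `\` A) <= e%:E)%E]) ->
  shift_continuous A.
Proof.
move=> H e e0; have e3 : 0 < e / 3 by rewrite divr_gt0.
have [B [cB AB BA]] := H _ e3.
apply: filterS (cB _ e3) => h hB.
have -> : e = e / 3 + e / 3 + e / 3 by field.
rewrite !EFinD; apply: le_trans (leeD (leeD AB hB) BA).
rewrite -(lebesgue_outer_rV_translate h (B `\` A)).
apply: le_trans (leeD (outer_measureU2 _ _ _) (lexx _)).
apply: le_trans (outer_measureU2 _ _ _); apply: le_outer_measure => z [Az Azh].
have [Bz|Bz] := pselect (B z); last by left; left.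
by have [Bzh|Bzh] := pselect (B (z + h)); [right|left; right].
Qed.

(** A cover by boxes of total volume below [outer A + e] has a union [U] exceeding [A] by at most
    [e]. As [U] has finite measure, finitely many of the boxes fill it up to [e], and their union
    approximates [A]. *)
Lemma shift_continuous_measurable A : measurable (A : set T) ->
  (outer A < +oo)%E -> shift_continuous A.
Proof.
move=> mA Aoo; apply: shift_continuous_approx => e e0.
have Afin : outer A \is a fin_num by rewrite ge0_fin_numE// outer_measure_ge0.
have [_ [s [sP As] <-] sA] := lb_ereal_inf_adherent e0 Afin.
pose D k : set T := box (s k).1 (s k).2.
pose U := \bigcup_k D k.
have mD k : measurable (D k) by exact: measurable_box.
have mU : measurable U by exact: bigcupT_measurable.
have Uvol : (mu U <= outer A + e%:E)%E.
  by rewrite (le_trans _ (ltW sA))//; apply: lebesgue_outer_rV_le; split.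
have Uoo : (mu U < +oo)%E by rewrite (le_lt_trans Uvol)// lte_add_pinfty// ltry.
pose F n := U `\` \bigcup_(k < n) D k.
have [n Fn] : exists n, (mu (F n) <= e%:E)%E.
  apply: nonincreasing_measure_small => //.
  - by rewrite /F bigcup_mkord big_ord0 setD0.
  - by move=> n; apply: measurableD => //; exact: bigcup_measurable.
  - apply/nonincreasing_seqP => n; apply/subsetPset => x [Ux nDx]; split=> //.
    by apply: contra_not nDx => -[k /= kn Dx]; exists k => //=; exact: ltnW.
  - apply/seteqP; split=> // x xF; have [[k _ Dx] _] := xF 0%N I.
    by have [_] := xF k.+1 I; apply; exists k => /=.
exists (\bigcup_(k < n) D k); split.
- rewrite bigcup_mkord; elim/big_ind : _ => [||k _].
  + exact: shift_continuous0.
  + exact: shift_continuousU.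
  + exact: shift_continuous_box.
- by apply: le_trans Fn; apply: le_outer_measure => x [Ax nx]; split=> //; exact: As.
- apply: (@le_trans _ _ (mu (U `\` A))).
    by apply: le_outer_measure => x [[k _ Dx] nx]; split=> //; exists k.
  have UA : U `&` A = A by apply/seteqP; split=> [x []//|x Ax]; split=> //; exact: As.
  by rewrite measureD// UA leeBlDr// addeC.
Qed.

(** * Measurability of convolutions *)

Lemma convolution_dist (K K' : T -> R) (f : T -> R) x x' :
  mu.-integrable setT (EFin \o K) -> mu.-integrable setT (EFin \o K') ->
  measurable_fun setT f -> (forall y, `|f y| <= 1) ->
  (`|convolution K f x - convolution K' f x'|%:E <=
    \int[mu]_y `|K (x - y : V)%R - K' (x' - y : V)%R|%:E)%E.
Proof.
move=> iK iK'.
exact: (Rintegral_mul_bounded_dist (integrable_reflect x iK) (integrable_reflect x' iK')).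
Qed.

Lemma convolution_indic_continuous A (f : T -> R) :
  measurable (A : set T) -> (mu A < +oo)%E ->
  measurable_fun setT f -> (forall y, `|f y| <= 1) ->
  continuous (convolution (\1_A : V -> R) (f : V -> R)).
Proof.
move=> mA Aoo mf f1 x.
have iA : mu.-integrable setT (EFin \o (\1_A : T -> R)) by exact: integrable_indicT.
apply/(@cvgrPdist_le _ _ _ _ (nbhs_filter x)) => e e0; have e2 : 0 < e / 2 by rewrite divr_gt0.
have [r /= r0 rP] := (nbhs_ballP _ _).1 (shift_continuous_measurable mA Aoo e2).
apply/nbhs_ballP; exists r => // x' [_ xx'].
have shift1 : ball (0 : V) r (x' - x).
  split=> // i j; have := xx' i j; rewrite /ball/= !mxE.
  by rewrite sub0r opprB.
have shift2 : ball (0 : V) r (x - x').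
  split=> // i j; have := xx' i j; rewrite /ball/= !mxE.
  by rewrite sub0r opprB distrC.
(* [D1] and [D2] are reflections of [shift_diff A (x' - x)] and [shift_diff A (x - x')]; together
   they form the set where the two shifted indicators differ. *)
pose D1 : set T := [set y | A (x - y) /\ ~ A (x' - y)].
pose D2 : set T := [set y | A (x' - y) /\ ~ A (x - y)].
have mAx z : measurable ([set y | A (z - y)] : set T) by exact: measurable_reflect_set.
have mD1 : measurable D1 by exact: (measurableD (mAx x) (mAx x')).
have mD2 : measurable D2 by exact: (measurableD (mAx x') (mAx x)).
have D1e : (mu D1 <= (e / 2)%:E)%E.
  apply: le_trans (rP _ shift1).
  rewrite -(lebesgue_outer_rV_reflect x (shift_diff A (x' - x))).
  by apply: le_outer_measure => y [h1 h2]; split => //; rewrite addrC subrKA.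
have D2e : (mu D2 <= (e / 2)%:E)%E.
  apply: le_trans (rP _ shift2).
  rewrite -(lebesgue_outer_rV_reflect x' (shift_diff A (x - x'))).
  by apply: le_outer_measure => y [h1 h2]; split => //; rewrite addrC subrKA.
rewrite -lee_fin; apply: le_trans (convolution_dist x x' iA iA mf f1) _.
rewrite [e]splitr EFinD; apply: le_trans (leeD D1e D2e).
exact: (le_integral_indicB mu (mAx x) (mAx x')).
Qed.

(** Integrability is kept alongside measurability so that convolution is additive on such
    kernels. *)
Definition convolution_measurable (f K : T -> R) :=
  mu.-integrable setT (EFin \o K) /\
  measurable_fun setT (convolution (K : V -> R) (f : V -> R) : T -> R).

Section fixed_function.
Variable f : T -> R.
Hypotheses (mf : measurable_fun setT f) (f1 : forall y, `|f y| <= 1).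

Lemma convolution_measurable0 : convolution_measurable f (fun=> 0).
Proof.
split; first exact: integrable0.
rewrite (_ : convolution _ _ = cst 0)//; apply/funext => x; rewrite /convolution.
under eq_Rintegral do rewrite mul0r.
by rewrite Rintegral_cst// mul0r.
Qed.

Lemma convolution_measurableD K K' : convolution_measurable f K ->
  convolution_measurable f K' -> convolution_measurable f (fun y => K y + K' y).
Proof.
move=> [iK mK] [iK' mK']; split; first exact: (integrableD measurableT iK iK').
rewrite (_ : convolution _ _ = fun x : V => convolution K f x + convolution K' f x).
  exact: measurable_funD.
apply/funext => x.
exact: (Rintegral_mul_boundedD (integrable_reflect x iK) (integrable_reflect x iK')).
Qed.

Lemma convolution_measurable_sum (I : Type) (r : seq I) (F : I -> T -> R) :
  (forall i, convolution_measurable f (F i)) ->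
  convolution_measurable f (fun y => \sum_(i <- r) F i y).
Proof.
move=> FP; elim: r => [|i r IH].
  rewrite (_ : (fun _ => _) = fun=> 0); first exact: convolution_measurable0.
  by apply/funext => y; rewrite big_nil.
rewrite (_ : (fun _ => _) = fun y => F i y + \sum_(j <- r) F j y).
  exact: convolution_measurableD.
by apply/funext => y; rewrite big_cons.
Qed.

(** Finite measure is asked only for [c != 0], since a simple integrable function may vanish on a
    set of infinite measure. *)
Lemma convolution_measurable_indic (c : R) (A : set T) : measurable A ->
  (c != 0 -> (mu A < +oo)%E) -> convolution_measurable f (fun y => c * \1_A y).
Proof.
move=> mA; have [->|c0] := eqVneq c 0.
  move=> _; rewrite (_ : (fun _ => _) = fun=> 0); first exact: convolution_measurable0.
  by apply/funext => y; rewrite mul0r.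
move=> /(_ isT) Aoo.
have iA : mu.-integrable setT (EFin \o (\1_A : T -> R)) by exact: integrable_indicT.
split; first exact: (integrableZl measurableT c iA).
rewrite (_ : convolution _ _ = fun x : V => c * convolution (\1_A : V -> R) f x).
  have mi : measurable_fun setT (convolution (\1_A : V -> R) f : T -> R).
    exact: continuous_measurable_rV (convolution_indic_continuous mA Aoo mf f1).
  exact: (measurable_funM (measurable_cst c) mi).
apply/funext => x; exact: (Rintegral_mul_boundedZ c (integrable_reflect x iA)).
Qed.

Import HBSimple.

Lemma convolution_measurable_sfun (g : {sfun T >-> R}) :
  mu.-integrable setT (EFin \o g) -> convolution_measurable f g.
Proof.
move=> ig; rewrite (funext (fimfunEord g)).
apply: convolution_measurable_sum => i; apply: convolution_measurable_indic.
  by rewrite -[X in measurable X]setTI; exact: measurable_funP.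
by move=> r0; apply: integrable_preimage_lty ig => //; exact: measurable_funP.
Qed.

(** With integrable simple [g n] tending to [K] in L^1, reflection invariance bounds the distance of
    the two convolutions at every [x] by the L^1 norm of [K - g n], so the convolution is a
    pointwise limit of measurable functions. *)
Lemma measurable_convolution (K : T -> R) : mu.-integrable setT (EFin \o K) ->
  measurable_fun setT (convolution (K : V -> R) (f : V -> R) : T -> R).
Proof.
move=> iK; have [g [ig _ gK]] := approximation_sfun_integrable measurableT iK.
apply: (@measurable_fun_cvg _ _ _ _
  (fun n => convolution (g n : V -> R) (f : V -> R) : T -> R)).
  by move=> n; exact: (convolution_measurable_sfun (ig n)).2.
move=> x _; apply/cvgrPdist_le => e e0.
move/fine_cvgP : gK => [fin /cvgrPdist_le/(_ _ e0) small].
apply: filterS2 fin small => n nfin; rewrite sub0r normrN => small.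
rewrite -lee_fin; apply: le_trans (convolution_dist x x iK (ig n) mf f1) _.
have iKg : mu.-integrable setT (EFin \o (fun y : T => K y - g n y)).
  exact: (integrableB measurableT iK (ig n)).
have mKg := integrable_measurable_norm iKg.
rewrite (ge0_integral_reflect x mKg (fun y => normr_ge0 (K y - g n y))).
move: small; rewrite -lee_fin; apply: le_trans.
by rewrite -[leLHS]fineK// lee_fin ler_norm.
Qed.

End fixed_function.

Lemma convolution_lip (K f f' : T -> R) (c : R) x :
  mu.-integrable setT (EFin \o K) ->
  measurable_fun setT f -> (forall y, `|f y| <= 1) ->
  measurable_fun setT f' -> (forall y, `|f' y| <= 1) ->
  (forall y, `|f y - f' y| <= c) -> 0 <= c ->
  `|convolution K f x - convolution K f' x| <= c * \int[mu]_y `|K y|.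
Proof.
move=> iK mf f1 mf' f1' ff' c0.
have K1fin : (\int[mu]_y `|K y|%:E)%E \is a fin_num.
  apply: (integrable_fin_num measurableT).
  exact: (integrable_norm iK).
have mK := integrable_measurable_norm iK.
rewrite -lee_fin EFinM [X in (_ * X)%E]fineK//.
rewrite -(ge0_integral_reflect x mK (fun y => normr_ge0 (K y))).
exact: (Rintegral_mul_le (integrable_reflect x iK)).
Qed.

End lebesgue_rV_theory.

(** * The Lenia arc field *)

Section clip01.
Context {R : realType}.
Implicit Types x y z p q : R.

Lemma clip01_cases x : [\/ x <= 0 /\ clip 0 1 x = 0,
  0 <= x <= 1 /\ clip 0 1 x = x | 1 <= x /\ clip 0 1 x = 1].
Proof.
have [x0|/ltW x0] := leP x 0; first by constructor 1; rewrite /clip max_l// min_l.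
have [x1|/ltW x1] := leP x 1.
  by constructor 2; split; [exact/andP|rewrite /clip max_r// min_l].
by constructor 3; rewrite /clip max_r// min_r.
Qed.

Lemma clip01_itv x : 0 <= clip 0 1 x <= 1.
Proof. by case: (clip01_cases x) => -[? ->]; rewrite ?lexx ?ler01. Qed.

Lemma clip01_id x : 0 <= x <= 1 -> clip 0 1 x = x.
Proof. by move=> /andP[x0 x1]; rewrite /clip max_r// min_l. Qed.

Lemma clip01_lip x y : `|clip 0 1 x - clip 0 1 y| <= `|x - y|.
Proof.
have h1 : x - y <= `|x - y| by exact: ler_norm.
have h2 : y - x <= `|x - y| by rewrite distrC; exact: ler_norm.
by rewrite ler_norml; apply/andP; split;
  case: (clip01_cases x) => -[hx ->]; case: (clip01_cases y) => -[hy ->]; lra.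
Qed.

(** If [z + p] leaves the interval, [p] points outwards, and so does [q] by equality of signs; both
    sides then stay at the same end. *)
Lemma clip01_add z p q : 0 <= z <= 1 -> 0 <= p /\ 0 <= q \/ p <= 0 /\ q <= 0 ->
  clip 0 1 (clip 0 1 (z + p) + q) = clip 0 1 (z + p + q).
Proof.
move=> /andP[z0 z1] pq; case: (clip01_cases (z + p)) => -[hx ->] //;
  [have := clip01_cases (0 + q)|have := clip01_cases (1 + q)].
all: case=> -[h ->]; case: (clip01_cases (z + p + q)) => -[hy ->].
all: by case: pq => -[p0 q0]; lra.
Qed.

Lemma measurable_clip01 d (T : measurableType d) (g : T -> R) :
  measurable_fun setT g -> measurable_fun setT (fun w => clip 0 1 (g w)).
Proof.
by move=> mg; apply: measurable_minr => //; exact: measurable_maxr.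
Qed.

End clip01.

Lemma unit_mfun_cauchy_cvg (R : realType) (m : nat) (u : nat -> unit_mfun R m) :
  (forall e : R, 0 < e -> exists n0, forall n p, (n0 <= n)%N -> (n0 <= p)%N ->
     mdist (u n) (u p) <= e) -> exists l : unit_mfun R m, u @ \oo --> l.
Proof.
move=> uC; suff : cvg (u @ \oo) by move=> ?; exists (lim (u @ \oo)).
apply: cauchy_cvg; apply/cauchy_ballP => e e0; rewrite near_map2.
have [n0 n0P] := uC _ (divr_gt0 e0 (ltr0n _ 2)).
exists ([set n | (n0 <= n)%N], [set n | (n0 <= n)%N]).
  by split; exists n0.
move=> [n p] [/= n0n n0p]; rewrite ballEmdist/= (le_lt_trans (n0P _ _ n0n n0p))//.
by rewrite ltr_pdivrMr// ltr_pMr// ltr1n.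
Qed.

(** * Estimates for the Lenia field *)

Section lenia.
Context {R : realType} {m : nat} (K : 'rV[R]_m.+1 -> R) (G : R -> R) (B l : R).
Local Notation mu := (lebesgue_measure_rV R m).
Local Notation M := (unit_mfun R m).
Hypothesis K_L1 : mu.-integrable setT (EFin \o K).
Hypothesis G_le : forall z, `|G z| <= B.
Hypothesis G_lip : forall y z, `|G y - G z| <= l * `|y - z|.
Hypothesis l_ge0 : 0 <= l.

Lemma measurable_lip : measurable_fun setT G.
Proof.
apply: continuous_measurable_fun => x; apply/cvgrPdist_le => e e0; near=> y.
rewrite (le_trans (G_lip _ _))// (@le_trans _ _ ((l + 1) * `|x - y|))//.
  by rewrite ler_wpM2r// lerDl.
rewrite mulrC -ler_pdivlMr ?ltr_wpDl//; near: y.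
apply: cvgr_dist_le; first exact: cvg_id.
by rewrite divr_gt0// ltr_wpDl.
Unshelve. all: by end_near. Qed.

Lemma measurable_lenia (f : M) t :
  measurable_fun [set: lebesgue_rV R m]
    ((fun x => clip 0 1 (f x + t * G (convolution K f x))) : lebesgue_rV R m -> R).
Proof.
apply: measurable_clip01.
have mf := measurable_unit_mfun f.
have f1 y : `|f y| <= 1.
  by have /andP[? ?] := unit_mfun_itv f y; rewrite ger0_norm.
have mc := measurable_convolution mf f1 K_L1.
exact: measurable_funD mf (measurable_funM (measurable_cst t)
  (measurableT_comp measurable_lip mc)).
Qed.

(** The formula is used at every real [t], so that the estimates below are global in time. *)
Definition lenia (f : M) t : M :=
  UnitMFun (measurable_lenia f t) (fun x => clip01_itv _).

Lemma convolution_supdist (f g : M) x :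
  `|convolution K f x - convolution K g x| <= mdist f g * \int[mu]_y `|K y|.
Proof.
have f1 (h : M) y : `|h y| <= 1.
  by have /andP[? ?] := unit_mfun_itv h y; rewrite ger0_norm.
by apply: (convolution_lip x K_L1 (measurable_unit_mfun f) _ (measurable_unit_mfun g));
  [exact: f1|exact: f1|exact: le_supdist|exact: mdist_ge0].
Qed.

Local Notation X := lenia.
Local Notation k := (\int[mu]_y `|K y|).

Let k_ge0 : 0 <= k.
Proof. by apply: Rintegral_ge0 => y _. Qed.

Let B_ge0 : 0 <= B.
Proof. by rewrite (le_trans _ (G_le 0)). Qed.

Lemma lenia0 f : X f 0 = f.
Proof.
apply: unit_mfun_ext => x /=; rewrite mul0r addr0 clip01_id//.
exact: unit_mfun_itv.
Qed.

Lemma lenia_lip f g t : 0 <= t ->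
  mdist (X f t) (X g t) <= (1 + t * (l * k)) * mdist f g.
Proof.
move=> t0; apply: supdist_le => x /=; rewrite (le_trans (clip01_lip _ _))//.
set u := G _; set v := G _.
have -> : f x + t * u - (g x + t * v) = (f x - g x) + t * (u - v) by ring.
rewrite (le_trans (ler_normD _ _))// mulrDl mul1r lerD//; first exact: le_supdist.
rewrite normrM ger0_norm// -mulrA ler_wpM2l// (le_trans (G_lip _ _))// -mulrA.
by rewrite ler_wpM2l// mulrC convolution_supdist.
Qed.

Lemma lenia_time f s t : mdist (X f s) (X f t) <= B * `|s - t|.
Proof.
apply: supdist_le => x /=; rewrite (le_trans (clip01_lip _ _))//.
rewrite opprD addrACA subrr add0r -mulrBl normrM mulrC.
by rewrite ler_wpM2r.
Qed.

(** Both sides become clippings of [X f s] plus [t] times a value of [G], taken at the convolutions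
    of [f] and of [X f s], whose distance is at most [B * s]. *)
Lemma lenia_semi f s t : 0 <= s -> 0 <= t ->
  mdist (X f (s + t)) (X (X f s) t) <= s * t * (B * l * k).
Proof.
move=> s0 t0; apply: supdist_le => x.
(* The increments over [s] and over [t] are nonnegative multiples of the same number, so clipping in
   two steps is allowed. *)
have -> : X f (s + t) x = clip 0 1 (X f s x + t * G (convolution K f x)).
  rewrite /= clip01_add ?unit_mfun_itv//; first by rewrite mulrDl addrA.
  by have [G0|/ltW G0] := leP 0 (G (convolution K f x)); [left|right];
    rewrite ?mulr_ge0 ?mulr_ge0_le0.
rewrite (le_trans (clip01_lip _ _))// opprD addrACA subrr add0r -mulrBr normrM.
rewrite ger0_norm// (_ : s * t * _ = t * (l * ((B * s) * k))); last by ring.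
rewrite ler_wpM2l// (le_trans (G_lip _ _))//.
rewrite ler_wpM2l// (le_trans (convolution_supdist _ _ _))// ler_wpM2r//.
have := lenia_time f 0 s; rewrite lenia0 sub0r normrN ger0_norm//.
Qed.

End lenia.

Theorem theorem2 (R : realType) (m : nat) (K : 'rV[R]_m.+1 -> R) (G : R -> R)
    (K_L1 : (lebesgue_measure_rV R m).-integrable setT (EFin \o K))
    (G_bounded : bounded_fun G) (G_lipschitz : lipschitz G) :
  exists X : unit_mfun R m -> R -> unit_mfun R m,
    [/\ forall f t x, 0 <= t <= 1 ->
          X f t x = clip 0 1 (f x + t * G (convolution K f x)),
        arc_field X, condition_E1 X, condition_E2 X &
        exists F : unit_mfun R m -> R -> unit_mfun R m,
          [/\ forward_flow F, forward_tangent F X,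
              forall F', forward_flow F' -> forward_tangent F' X ->
                forall f t, 0 <= t -> F' f t = F f t &
              forall f t, 0 <= t -> euler_curve X f t @ \oo --> F f t]].

Proof.
have [B B0 GB] : exists2 B : R, 0 < B & forall z, `|G z| <= B.
  by have [B B0 H] := pinfty_ex_gt0 G_bounded; exists B => // z; exact: H.
have [l l0 Gl] : exists2 l : R, 0 < l & forall y z, `|G y - G z| <= l * `|y - z|.
  by have [l l0 H] := pinfty_ex_gt0 G_lipschitz; exists l => // y z; exact: (H (y, z)).
pose k := \int[lebesgue_measure_rV R m]_y `|K y|.
have k0 : 0 <= k by apply: Rintegral_ge0 => y _.
pose X := lenia K_L1 Gl (ltW l0).
have X0 : forall f, X f 0 = f by exact: lenia0.
have X_lip : forall f g t, 0 <= t ->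
    mdist (X f t) (X g t) <= (1 + t * (l * k)) * mdist f g by exact: lenia_lip.
have X_time : forall f s t, mdist (X f s) (X f t) <= B * `|s - t|.
  exact: lenia_time.
have X_semi : forall f s t, 0 <= s -> 0 <= t ->
    mdist (X f (s + t)) (X (X f s) t) <= s * t * (B * l * k).
  exact: lenia_semi.
have lk0 : 0 <= l * k by rewrite mulr_ge0// ltW.
exists X; split => //.
- split=> //; apply: lip_within_continuous => f t.
  rewrite /= in_itv/= => /andP[t0 t1]; exists (Num.max (1 + t * (l * k)) B) => g s _ _.
  rewrite (le_trans (metric_triangle _ (X g t) _))// mulrDr lerD//.
    by rewrite (le_trans (X_lip _ _ _ t0))// ler_wpM2r ?mdist_ge0// le_max lexx.
  by rewrite (le_trans (X_time _ _ _))// ler_wpM2r// le_max lexx orbT.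
(* The estimates being global, any radius serves, and [delta] is the largest one permitted; likewise
   for the next condition. *)
- move=> f0; exists 1, 1, (l * k); split=> // f g t _ _ /andP[t0 _]; exact: X_lip.
- move=> f0; exists 1, 2^-1, (B * l * k); split=> // f s t _ t0 ts _.
  by apply: X_semi => //; exact: le_trans ts.
- apply: (arc_field_flow lk0 _ (ltW B0) X0 X_lip X_semi X_time).
    by rewrite !mulr_ge0// ltW.
  exact: unit_mfun_cauchy_cvg.
Qed.
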